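(* There exists a constant $c$ such that for all integers $d,k\geq 2$, \[ C_k(d) \leq c\, k\, (e/2)^{k}\, d^{\frac{k-2}{2}}. \]
   Context: $\mathbb{D}^d=\{z\in\mathbb{C}^d: |z_1|,\dots,|z_d|<1\}$. For a polynomial $p\in\mathbb{C}[z_1,\dots,z_d]$, let $\|p\|_\infty=\sup\{|p(z)|: z\in\mathbb{D}^d\}$ and define the Agler norm $\|p\|_A=\sup\{\|p(T)\|\}$, where $\|p(T)\|$ is the operator norm and the supremum is taken over all $d$-tuples $T=(T_1,\dots,T_d)$ of pairwise commuting strictly contractive operators ($\|T_j\|<1$) on a common complex Hilbert space. Define \[ C_{k}(d) = \sup\left\{ \frac{\|p\|_{A}}{\|p\|_{\infty}}: p\in \mathbb{C}[z_1,\dots, z_d] \text{ nonzero, homogeneous of degree } k\right\}. \] *)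

(* Defs.v *)
From mathcomp Require Import all_boot all_order all_algebra.
From mathcomp Require Import complex.
From mathcomp Require Import all_classical all_reals all_analysis.
(* The notations of mpoly clash with those of mathcomp-analysis. *)
From mathcomp Require Import -(notations) mpoly.

Set Implicit Arguments.
Unset Strict Implicit.
Unset Printing Implicit Defensive.

Import Order.TTheory GRing.Theory Num.Theory.
Import numFieldNormedType.Exports.

Local Open Scope classical_set_scope.
Local Open Scope complex_scope.
Local Open Scope ring_scope.

(* Complex Hilbert spaces, with inner product linear in the first argument;
   completeness is part of [completeNormedModType]. *)
Record hilbert (R : realType) := Hilbert {
  hilbert_sort :> completeNormedModType R[i] ;
  inner : {dot hilbert_sort for Num.conj} ;
  inner_norm : forall x : hilbert_sort, `|x| ^+ 2 = inner x x }.
Arguments inner {R} h.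

(* Norms over R[i] take values in R[i] (with zero imaginary part), hence the
   projections [complex.Re] below. Suprema are taken in the extended reals, so
   that an operator is bounded exactly when its norm is not +oo. *)
Definition opnorm (R : realType) (H : hilbert R) (f : H -> H) : \bar R :=
  ereal_sup [set (complex.Re `|f x|)%:E | x in [set x : H | `|x| <= 1]].

(* p(T) = \sum_m p_m T_0^{m_0} ... T_{d-1}^{m_{d-1}}, applied to x. *)
Definition opeval (R : realType) (H : hilbert R) (d : nat)
    (p : mpoly d R[i]) (T : 'I_d -> H -> H) (x : H) : H :=
  \sum_(m <- msupp p)
    mcoeff m p *:
      (\big[@comp H H H/id]_(j < d) iter (m j) (T j)) x.

Definition polydisc (R : realType) (d : nat) : set ('I_d -> R[i]) :=
  [set z | forall j, `|z j| < 1].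

Definition supnorm (R : realType) (d : nat) (p : mpoly d R[i]) : \bar R :=
  ereal_sup [set (complex.Re `|meval z p|)%:E | z in @polydisc R d].

Definition commuting_strict_contractions (R : realType) (H : hilbert R)
    (d : nat) (T : 'I_d -> {linear H -> H}) : Prop :=
  (forall j, (opnorm (T j) < 1)%E) /\
  (forall i j, T i \o T j = T j \o T i :> (H -> H)).

Definition aglernorm (R : realType) (d : nat) (p : mpoly d R[i]) : \bar R :=
  ereal_sup [set a | exists (H : hilbert R) (T : 'I_d -> {linear H -> H}),
    commuting_strict_contractions T /\ a = opnorm (opeval p (fun j => T j))].

(* The division is the one of extended reals; for p nonzero, supnorm p is a
   positive real number. *)
Definition Cconst (R : realType) (k d : nat) : \bar R :=
  ereal_sup [set (aglernorm p / supnorm p)%E |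
    p in [set p : mpoly d R[i] |
            p != 0 /\ p \is ishomog1 k mdeg]].

(* Main.v *)
Require Import Defs.
From HB Require Import structures.
From mathcomp Require Import all_boot all_order all_algebra.
From mathcomp Require Import complex.
From mathcomp Require Import all_classical all_reals all_analysis.
From mathcomp Require Import -(notations) mpoly.
From mathcomp Require Import cyclic separable cyclotomic.
From mathcomp Require Import ring lra zify.

Set Implicit Arguments.
Unset Strict Implicit.
Unset Printing Implicit Defensive.

Import Order.TTheory GRing.Theory Num.Theory.
Import numFieldNormedType.Exports.

Local Open Scope ring_scope.

(** The bound comes from Grothendieck's inequality applied to the second
   derivatives of [p]. Put [n = k - 2] and let [M] be the supremum norm of
   [p]. Euler's identity, used twice, writes [k (k - 1) p(T)] as the sum over
   [i], [j] and the multi-indices [t] of degree [n] of [c i (j, t)] times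
   [T_i T_j T^t], where [c i (j, t)] is the coefficient of [z^t] in
   [d_j d_i p] (lemma [monomial_sum_euler_homog]). Hence, for vectors [h] and
   [g] of norm at most 1, [k (k - 1) <p(T) h, g>] is the sum of
   [c i (j, t) * <T_i u_(j,t), g>] with [u_(j,t) = T_j T^t h], a sum of
   pairings between functionals of norm at most 1, indexed by [i], and vectors
   of norm at most 1, indexed by the pairs [(j, t)]. Grothendieck's inequality
   (lemma [grothendieck_functionals]) reduces its estimation to scalars: what
   matters is the largest value of the sum over [(j, t)] of
   [|sum_i x_i c i (j, t)|] for complex numbers [x_i] of modulus at most 1.

   For fixed [x] and [j] the inner sum over [t] is the sum of the moduli of
   the coefficients of the homogeneous polynomial [d_j f] of degree [n], where
   [f = sum_i x_i d_i p]. Cauchy-Schwarz over the [N] multi-indices, followed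
   by a comparison of the L2 and L1 norms on the torus, bounds it by
   [sqrt (N L)] times the L1 norm of [d_j f] (lemma [sum_coef_le_mean]); here
   [L] is the largest number of ways to write a multi-index as an ordered sum
   of two multi-indices of degree [n], and it controls the L4 norm by the L2
   norm. Passing to L1 is the decisive step, because the L1 norms can be added
   over [j] under the mean: at each point [z], the sum of the [|d_j f (z)|] is
   a value of the bilinear form of second derivatives of [p] at [z], and
   Cauchy's estimate bounds it by a constant times [k^2 M] (lemma
   [sum_dir_deriv2_le]). The sum over the [d] values of [j] thus costs
   nothing, and the power of [d] comes from [sqrt N] alone, with [n] free
   indices instead of [n + 1].

   It remains to see that [sqrt (N L) <= k (e/2)^n d^(n/2)]. Now [L] is at
   most both [N] and [4^n], and [N] is the binomial coefficient counting the
   monomials, equal to [n + 1] when [d = 2] and at most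
   ['C(n + 2, 2) (d/3)^n] when [d >= 3]. So [L <= N] settles [d = 2], and [L <= 4^n]
   settles [d >= 3], because [2 / sqrt 3 <= e / 2].

   A mean over the torus stands throughout for a finite mean over roots of
   unity whose order exceeds all the exponents that occur. *)

(** * Real-valued norms *)

(** The norm of a complex normed space, as an element of [R] rather than of
   [R[i]], whose order is only partial. *)
Definition rnorm (R : rcfType) (V : normedZmodType R[i]) (v : V) : R :=
  complex.Re `|v|.

(** [real_complex] can be read at several convertible ring structures on [R];
   this constant fixes one of them, so that its laws are usable for
   rewriting. *)
Definition realc (R : rcfType) (r : R) : R[i] := (r%:C)%C.

Section RealNorm.
Variable R : rcfType.
Implicit Types (V : normedZmodType R[i]) (a b : R[i]).

Lemma realcI : injective (@realc R).
Proof. exact: complexI. Qed.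

Lemma realc_le (r s : R) : (realc r <= realc s) = (r <= s).
Proof. exact: lecR. Qed.

Lemma realc_lt (r s : R) : (realc r < realc s) = (r < s).
Proof. exact: ltcR. Qed.

Lemma realcD (r s : R) : realc (r + s) = realc r + realc s :> R[i].
Proof. exact: rmorphD. Qed.

Lemma realcM (r s : R) : realc (r * s) = realc r * realc s :> R[i].
Proof. exact: rmorphM. Qed.

Lemma realcX (r : R) n : realc (r ^+ n) = realc r ^+ n :> R[i].
Proof. exact: rmorphXn. Qed.

Lemma realcV (r : R) : realc (r^-1) = (realc r)^-1 :> R[i].
Proof. exact: fmorphV. Qed.

Lemma realc_sum (I : Type) (s : seq I) (P : pred I) (F : I -> R) :
  realc (\sum_(i <- s | P i) F i) = \sum_(i <- s | P i) realc (F i) :> R[i].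
Proof. exact: rmorph_sum. Qed.

Lemma realc_nat n : realc (n%:R : R) = n%:R :> R[i].
Proof. exact: rmorph_nat. Qed.

Lemma rnormE V (v : V) : realc (rnorm v) = `|v|.
Proof. by apply: RRe_real; rewrite normr_real. Qed.

Lemma rnorm_le V (v : V) (r : R) : (rnorm v <= r) = (`|v| <= (realc r)).
Proof. by rewrite -rnormE realc_le. Qed.

Lemma rnorm_lt V (v : V) (r : R) : (rnorm v < r) = (`|v| < (realc r)).
Proof. by rewrite -rnormE realc_lt. Qed.

Lemma rnorm_ge0 V (v : V) : 0 <= rnorm v.
Proof. by rewrite -realc_le rnormE normr_ge0. Qed.

Lemma rnorm0 V : rnorm (0 : V) = 0.
Proof. by rewrite /rnorm normr0. Qed.

Lemma rnorm_eq0 V (v : V) : (rnorm v == 0) = (v == 0).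
Proof. by rewrite -(inj_eq realcI) rnormE normr_eq0. Qed.

Lemma rnormD V (v w : V) : rnorm (v + w) <= rnorm v + rnorm w.
Proof. by rewrite rnorm_le realcD !rnormE ler_normD. Qed.

Lemma rnorm_sum V (I : Type) (s : seq I) (P : pred I) (F : I -> V) :
  rnorm (\sum_(i <- s | P i) F i) <= \sum_(i <- s | P i) rnorm (F i).
Proof.
rewrite rnorm_le realc_sum.
apply: (le_trans (ler_norm_sum _ _ _)).
by apply: ler_sum => i _; rewrite rnormE.
Qed.

Lemma rnormM a b : rnorm (a * b) = rnorm a * rnorm b.
Proof. by apply: realcI; rewrite realcM !rnormE normrM. Qed.

Lemma rnormX a n : rnorm (a ^+ n) = rnorm a ^+ n.
Proof. by apply: realcI; rewrite realcX !rnormE normrX. Qed.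

Lemma rnormJ a : rnorm (Num.conj a) = rnorm a.
Proof. by apply: realcI; rewrite !rnormE norm_conjC. Qed.

Lemma rnormC (r : R) : rnorm (realc r) = `|r|.
Proof. by apply: realcI; rewrite rnormE /realc normc_def /= expr0n addr0 sqrtr_sqr. Qed.

Lemma rnorm1 : rnorm (1 : R[i]) = 1.
Proof. by rewrite -[1]/(realc 1) rnormC normr1. Qed.

Lemma rnormV a : rnorm a^-1 = (rnorm a)^-1.
Proof. by apply: realcI; rewrite realcV !rnormE normfV. Qed.

Lemma rnorm_sqr a : realc (rnorm a ^+ 2) = a * Num.conj a.
Proof. by rewrite realcX rnormE normCK. Qed.

Lemma conj_real (r : R) : Num.conj (realc r) = realc r.
Proof. by apply/CrealP; apply/complex_realP; exists r. Qed.

Lemma rnorm_phase a : exists2 u : R[i], rnorm u <= 1 & u * a = realc (rnorm a).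
Proof.
have [->|a0] := eqVneq a 0; first by exists 1; rewrite ?rnorm1 // rnorm0 mulr0.
exists (realc (rnorm a) / a); last by rewrite divfK.
by rewrite rnormM rnormV rnormC ger0_norm ?rnorm_ge0 // divff // rnorm_eq0.
Qed.

End RealNorm.

(** * Averages over roots of unity *)

Section Torus.
Variables (R : rcfType) (Q : nat) (zeta : R[i]).
Hypothesis zetaP : Q.-primitive_root zeta.
Notation C := R[i].

Let norm_zeta : `|zeta| = 1.
Proof.
have: `|zeta| ^+ Q = 1 by rewrite -normrX prim_expr_order // normr1.
move/eqP; rewrite pexpr_eq1 ?normr_ge0 //; first by move=> /eqP.
exact: prim_order_gt0 zetaP.
Qed.

Definition torus_pt (J : finType) (z : {ffun J -> 'I_Q}) (j : J) : C :=
  zeta ^+ z j.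

Lemma rnorm_torus_pt (J : finType) (z : {ffun J -> 'I_Q}) j :
  rnorm (torus_pt z j) = 1.
Proof. by rewrite rnormX -[rnorm zeta]/(complex.Re _) norm_zeta expr1n. Qed.

Definition mono (J : finType) (a : {ffun J -> nat}) (v : J -> C) : C :=
  \prod_j v j ^+ a j.

Lemma monoD (J : finType) (a b : {ffun J -> nat}) v :
  mono a v * mono b v = mono [ffun j => (a j + b j)%N] v.
Proof.
by rewrite -big_split /=; apply: eq_bigr => j _; rewrite ffunE exprD.
Qed.

(** The product of the two powers is the [i]-th power of a single [Q]-th root
   of unity, which is 1 only if [a = b]; otherwise the geometric sum
   vanishes. *)
Lemma prim_root_ortho a b : (a < Q)%N -> (b < Q)%N ->
  \sum_(i < Q) (zeta ^+ i) ^+ a * Num.conj ((zeta ^+ i) ^+ b) =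
  (Q * (a == b))%:R.
Proof.
move=> aQ bQ; set w := zeta ^+ a * Num.conj (zeta ^+ b).
have zb : zeta ^+ b * Num.conj (zeta ^+ b) = 1.
  by rewrite -normCK normrX norm_zeta !expr1n.
rewrite (eq_bigr (fun i : 'I_Q => w ^+ i)); last first.
  by move=> i _; rewrite /w exprMn -rmorphXn -!exprM mulnC (mulnC b).
have wQ : w ^+ Q = 1.
  rewrite /w exprMn -rmorphXn -!exprM mulnC exprM (mulnC b) exprM.
  by rewrite (prim_expr_order zetaP) !expr1n rmorph1 mul1r.
case: eqVneq => [eab|nab].
  rewrite muln1 (eq_bigr (fun _ => 1)) ?sumr_const ?card_ord // => i _.
  by rewrite /w eab zb expr1n.
rewrite muln0; have w1 : w - 1 != 0.
  rewrite subr_eq0; apply: contra nab => /eqP w1.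
  have : zeta ^+ a == zeta ^+ b.
    by rewrite -[zeta ^+ a]mulr1 -zb mulrA mulrAC -/w w1 mul1r.
  by rewrite (eq_prim_root_expr zetaP) !modn_small.
by apply: (mulfI w1); rewrite mulr0 -subrX1 wQ subrr.
Qed.

Lemma mono_ortho (J : finType) (a b : {ffun J -> nat}) :
  (forall j, a j < Q)%N -> (forall j, b j < Q)%N ->
  \sum_(z : {ffun J -> 'I_Q})
    mono a (torus_pt z) * Num.conj (mono b (torus_pt z)) =
  (Q ^ #|J| * (a == b))%:R.
Proof.
move=> aQ bQ.
under eq_bigr do rewrite rmorph_prod -big_split /=.
rewrite -(bigA_distr_bigA (fun j (i : 'I_Q) =>
   (zeta ^+ i) ^+ a j * Num.conj ((zeta ^+ i) ^+ b j))).
under eq_bigr do rewrite prim_root_ortho //.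
case: eqVneq => [->|nab].
  under eq_bigr do rewrite eqxx muln1.
  by rewrite prodr_const muln1 natrX.
have [j nj] : exists j, a j != b j.
  apply/existsP; rewrite -negb_forall; apply: contra nab => /forallP ab.
  by apply/eqP/ffunP => j; apply/eqP/ab.
by rewrite (bigD1 j) //= (negPf nj) !muln0 mul0r.
Qed.

Section Moments.
Variables (I J : finType) (e : I -> {ffun J -> nat}).
Hypothesis e_inj : injective e.
Hypothesis e_small : forall s t j, (e s j + e t j < Q)%N.

(** Polynomials with exponents in the range of an arbitrary injective family
   [e], so that linear forms and homogeneous polynomials are both covered. *)
Definition mpol (b : I -> C) (v : J -> C) : C := \sum_t b t * mono (e t) v.

Let e_small1 t j : (e t j < Q)%N.
Proof. by apply: leq_ltn_trans (e_small t t j); rewrite leq_addr. Qed.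

Lemma mpol_ortho b c :
  \sum_(z : {ffun J -> 'I_Q}) mpol b (torus_pt z) * Num.conj (mpol c (torus_pt z))
  = (Q ^ #|J|)%:R * \sum_t b t * Num.conj (c t).
Proof.
under eq_bigr do rewrite /mpol rmorph_sum /= mulr_suml.
rewrite exchange_big /= mulr_sumr; apply: eq_bigr => s _.
under eq_bigr do rewrite mulr_sumr.
rewrite exchange_big /= (bigD1 s) //= [X in _ + X]big1 ?addr0.
  rewrite (eq_bigr (fun z => (b s * Num.conj (c s)) *
    (mono (e s) (torus_pt z) * Num.conj (mono (e s) (torus_pt z))))); last first.
    by move=> z _; rewrite rmorphM mulrACA.
  by rewrite -mulr_sumr mono_ortho // eqxx muln1 mulrC.
move=> t ts.
rewrite (eq_bigr (fun z => (b s * Num.conj (c t)) *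
    (mono (e s) (torus_pt z) * Num.conj (mono (e t) (torus_pt z))))); last first.
  by move=> z _; rewrite rmorphM mulrACA.
by rewrite -mulr_sumr mono_ortho // (inj_eq e_inj) eq_sym (negPf ts) muln0 mulr0.
Qed.

Lemma mpol_parseval b :
  \sum_(z : {ffun J -> 'I_Q}) rnorm (mpol b (torus_pt z)) ^+ 2 =
  (Q ^ #|J|)%:R * \sum_t rnorm (b t) ^+ 2.
Proof.
apply: (@realcI R); rewrite realcM !realc_sum realc_nat.
under eq_bigr do rewrite rnorm_sqr.
by rewrite mpol_ortho; congr (_ * _); apply: eq_bigr => t _; rewrite rnorm_sqr.
Qed.

Variable L : nat.
Hypothesis collisions : forall s t,
  (#|[set st : I * I | [forall j, (e st.1 j + e st.2 j == e s j + e t j)%N]]| <= L)%N.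

(** The fourth moment of a polynomial is the second moment of its square. The
   coefficients of the square that meet at one monomial are at most [L] in
   number, and products of two of them are split by
   [|a b| <= (|a|^2 + |b|^2) / 2]. *)
Lemma mpol_moment4 b :
  \sum_(z : {ffun J -> 'I_Q}) rnorm (mpol b (torus_pt z)) ^+ 4 <=
  (Q ^ #|J|)%:R * (L%:R * (\sum_t rnorm (b t) ^+ 2) ^+ 2).
Proof.
pose esum (st : I * I) : {ffun J -> nat} := [ffun j => (e st.1 j + e st.2 j)%N].
pose bb (st : I * I) := b st.1 * b st.2.
pose eqs (p q : I * I) : R := (esum p == esum q)%:R.
have sqE (v : J -> C) : mpol b v ^+ 2 = \sum_p bb p * mono (esum p) v.
  rewrite expr2 /mpol mulr_suml (eq_bigr (fun s => \sum_t
    bb (s, t) * mono (esum (s, t)) v)); first by rewrite pair_bigA.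
  by move=> s _; rewrite mulr_sumr; apply: eq_bigr => t _; rewrite mulrACA monoD.
have E4 : realc (\sum_(z : {ffun J -> 'I_Q}) rnorm (mpol b (torus_pt z)) ^+ 4)
  = (Q ^ #|J|)%:R * \sum_p \sum_q bb p * Num.conj (bb q) * realc (eqs p q).
  rewrite realc_sum.
  rewrite (eq_bigr (fun z : {ffun J -> 'I_Q} => \sum_p \sum_q (bb p * Num.conj (bb q)) *
     (mono (esum p) (torus_pt z) * Num.conj (mono (esum q) (torus_pt z)))));
     last first.
    move=> z _; rewrite (exprM _ 2 2) -rnormX rnorm_sqr sqE rmorph_sum mulr_suml.
    apply: eq_bigr => p _; rewrite mulr_sumr; apply: eq_bigr => q _.
    by rewrite rmorphM mulrACA.
  rewrite exchange_big mulr_sumr /=; apply: eq_bigr => p _.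
  rewrite exchange_big mulr_sumr /=; apply: eq_bigr => q _.
  rewrite -mulr_sumr mono_ortho; try by move=> j; rewrite ffunE.
  by rewrite natrM realc_nat mulrCA.
pose a p := rnorm (bb p) ^+ 2.
have aE : \sum_p a p = (\sum_t rnorm (b t) ^+ 2) ^+ 2.
  rewrite expr2 mulr_suml (eq_bigr (fun s => \sum_t a (s, t))).
    by rewrite pair_bigA; apply: eq_bigr => -[].
  by move=> s _; rewrite mulr_sumr; apply: eq_bigr => t _; rewrite /a rnormM exprMn.
have a0 p : 0 <= a p by rewrite exprn_ge0 ?rnorm_ge0.
have cnt p : \sum_q eqs q p <= L%:R.
  rewrite /eqs -natr_sum ler_nat.
  apply: leq_trans (collisions p.1 p.2).
  rewrite -sum1dep_card [leqRHS]big_mkcond /=; apply: leq_sum => q _.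
  case: eqP => [/ffunP h|//]; rewrite ifT //; apply/forallP => j.
  by have := h j; rewrite !ffunE => ->.
rewrite -[leLHS]ger0_norm; last by apply: sumr_ge0 => z _; rewrite exprn_ge0 ?rnorm_ge0.
rewrite -rnormC E4 rnormM -realc_nat rnormC ger0_norm ?ler0n //.
rewrite ler_wpM2l ?ler0n //.
apply: le_trans (rnorm_sum _ _ _) _.
apply: (@le_trans _ _ (\sum_p \sum_q (a p + a q) / 2 * eqs p q)).
  apply: ler_sum => p _; apply: le_trans (rnorm_sum _ _ _) _.
  apply: ler_sum => q _; rewrite 2!rnormM rnormC rnormJ normr_nat.
  rewrite ler_wpM2r ?ler0n // /a.
  by have := sqr_ge0 (rnorm (bb p) - rnorm (bb q)); lra.
have eqsC p q : eqs p q = eqs q p by rewrite /eqs eq_sym.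
have S1 : \sum_p \sum_q a p * eqs p q <= L%:R * \sum_p a p.
  rewrite mulr_sumr; apply: ler_sum => p _; rewrite -mulr_sumr mulrC.
  by rewrite ler_wpM2r //; under eq_bigr do rewrite eqsC; exact: cnt.
have S2 : \sum_p \sum_q a q * eqs p q <= L%:R * \sum_p a p.
  rewrite exchange_big /= mulr_sumr; apply: ler_sum => p _; rewrite -mulr_sumr mulrC.
  by rewrite ler_wpM2r.
rewrite -aE (eq_bigr (fun p => 2^-1 * \sum_q a p * eqs p q +
  2^-1 * \sum_q a q * eqs p q)); last first.
  by move=> p _; rewrite !mulr_sumr -big_split; apply: eq_bigr => q _ /=; lra.
by rewrite big_split /= -!mulr_sumr; lra.
Qed.

End Moments.
End Torus.

(** [X^n - 1] is separable, so an algebraically closed field contains [n]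
   distinct roots of it. *)
Lemma exists_prim_root (F : numClosedFieldType) n :
  (0 < n)%N -> exists z : F, n.-primitive_root z.
Proof.
move=> n_gt0; have [r rE] := closed_field_poly_normal ('X^n - 1 : {poly F}).
rewrite (monicP _) ?monicXnsubC // scale1r in rE.
have r_root : all n.-unity_root r by apply/allP => z; rewrite -root_prod_XsubC -rE.
have r_uniq : uniq r.
  by rewrite -separable_prod_XsubC -rE separable_Xn_sub_1 // pnatr_eq0 -lt0n.
have r_size : (n <= size r)%N.
  by rewrite -ltnS -(size_prod_XsubC r id) -rE size_XnsubC.
by have /hasP[z _ zP] := has_prim_root n_gt0 r_root r_uniq r_size; exists z.
Qed.

Lemma sqr_sum_le (R : realDomainType) (I : finType) (x : I -> R) :
  (\sum_t x t) ^+ 2 <= #|I|%:R * \sum_t x t ^+ 2.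
Proof.
have : 0 <= \sum_s \sum_t (x s - x t) ^+ 2.
  by do 2![apply: sumr_ge0 => ? _]; apply: sqr_ge0.
rewrite (eq_bigr (fun s => #|I|%:R * x s ^+ 2 - 2 * x s * (\sum_t x t)
  + \sum_t x t ^+ 2)); last first.
  move=> s _; rewrite (eq_bigr (fun t => x s ^+ 2 - 2 * x s * x t + x t ^+ 2)).
    by rewrite !big_split /= sumr_const sumrN -mulr_sumr -[_ *+ #|_|]mulr_natl.
  by move=> t _; ring.
rewrite !big_split /= sumrN -!mulr_suml -!mulr_sumr sumr_const.
by rewrite -[_ *+ #|_|]mulr_natl expr2; lra.
Qed.

(** A collision is a way to rewrite the exponent of a product of two
   monomials. Its first component determines the second one, which gives the
   first bound below. It is also an exponent below the given sum of total
   degree [2 n], and there are [prod_j (m_j + 1) <= prod_j 2^(m_j) = 4^n] of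
   these, which gives the second. *)
Section Collisions.
Variables (I J : finType) (Q : nat) (e : I -> {ffun J -> nat}).
Hypothesis e_inj : injective e.
Hypothesis e_small : forall s t j, (e s j + e t j < Q)%N.

Let coll (s t : I) :=
  [set st : I * I | [forall j, (e st.1 j + e st.2 j == e s j + e t j)%N]].

Let coll_inj s t : {in coll s t &, injective fst}.
Proof.
move=> [s1 t1] [s2 t2]; rewrite !inE /= => /forallP h1 /forallP h2 s12.
congr pair => //; apply: e_inj; apply/ffunP => j; apply/eqP.
have /eqP /= E1 := h1 j; have /eqP /= E2 := h2 j.
by rewrite -(eqn_add2l (e s1 j)) E1 s12 E2.
Qed.

Lemma collisions_le_card s t : (#|coll s t| <= #|I|)%N.
Proof. by rewrite -(card_in_imset (@coll_inj s t)) max_card. Qed.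

Lemma collisions_le_pow s t n :
  (\sum_j e s j = n)%N -> (\sum_j e t j = n)%N -> (#|coll s t| <= 4 ^ n)%N.
Proof.
move=> sn tn; have e1 u j : (e u j < Q)%N.
  by apply: leq_ltn_trans (e_small u u j); rewrite leq_addr.
pose f (st : I * I) : {ffun J -> 'I_Q} := [ffun j => Ordinal (e1 st.1 j)].
pose B (j : J) := [pred x : 'I_Q | x < (e s j + e t j).+1]%N.
have f_inj : {in coll s t &, injective f}.
  move=> p q pc qc fpq; apply: (coll_inj pc qc); apply: e_inj.
  apply/ffunP => j; have /(congr1 (fun g : {ffun J -> 'I_Q} => val (g j))) := fpq.
  by rewrite !ffunE.
rewrite -(card_in_imset f_inj).
apply: (@leq_trans #|family B|).
  apply: subset_leq_card; apply/fintype.subsetP => _ /imsetP[p pc ->].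
  apply/familyP => j; rewrite ffunE inE /= ltnS.
  by move: pc; rewrite inE => /forallP/(_ j)/eqP <-; rewrite leq_addr.
rewrite card_family foldrE big_map big_enum /=.
apply: (@leq_trans (\prod_j 2 ^ (e s j + e t j))%N).
  apply: leq_prod => j _.
  rewrite -sum1_card -(big_ord_widen Q (fun=> 1%N)) ?sum1_card ?card_ord //.
  exact: ltn_expl.
by rewrite -expn_sum big_split /= sn tn -[4%N]/(2 ^ 2)%N -expnM mul2n addnn.
Qed.

End Collisions.

Section CoefficientSum.
Variables (R : rcfType) (Q : nat) (zeta : R[i]).
Hypothesis zetaP : Q.-primitive_root zeta.
Variables (I J : finType) (e : I -> {ffun J -> nat}).
Hypothesis e_inj : injective e.
Hypothesis e_small : forall s t j, (e s j + e t j < Q)%N.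
Variable L : nat.
Hypothesis collisions : forall s t,
  (#|[set st : I * I | [forall j, (e st.1 j + e st.2 j == e s j + e t j)%N]]| <= L)%N.

(** Write [A] for the sum of the squared moduli of the coefficients. Summing
   [3 l^2 F^2 <= 2 l^3 F + F^4] over the torus for [l^2 = L A], and using the
   bound on the fourth moment, yields [sqrt A <= sqrt L * mean F]; the sum of
   the moduli is at most [sqrt (#|I| * A)]. *)
Lemma sum_coef_le_mean (b : I -> R[i]) :
  (Q ^ #|J|)%:R * \sum_t rnorm (b t) <=
  Num.sqrt (#|I| * L)%:R *
    \sum_(z : {ffun J -> 'I_Q}) rnorm (mpol e b (torus_pt zeta z)).
Proof.
pose W : R := (Q ^ #|J|)%:R; pose A := \sum_t rnorm (b t) ^+ 2.
pose F (z : {ffun J -> 'I_Q}) := rnorm (mpol e b (torus_pt zeta z)).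
have m2 : \sum_z F z ^+ 2 = W * A := mpol_parseval zetaP e_inj e_small b.
have m4 : \sum_z F z ^+ 4 <= W * (L%:R * A ^+ 2) :=
  mpol_moment4 zetaP e_small collisions b.
rewrite -/W -/(\sum_z F z).
have A0 : 0 <= A by apply: sumr_ge0 => t _; apply: sqr_ge0.
have F0 z : 0 <= F z by apply: rnorm_ge0.
have S0 : 0 <= \sum_z F z by apply: sumr_ge0.
have W0 : 0 < W by rewrite ltr0n expn_gt0 (prim_order_gt0 zetaP).
have CS := sqr_sum_le (fun t => rnorm (b t)).
have [A_eq0|A_neq0] := eqVneq A 0.
  have -> : \sum_t rnorm (b t) = 0.
    apply/eqP; rewrite -sqrf_eq0 eq_le sqr_ge0 andbT.
    by apply: le_trans CS _; rewrite -/A A_eq0 mulr0.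
  by rewrite mulr0 mulr_ge0 ?sqrtr_ge0.
have A_gt0 : 0 < A by rewrite lt_def A_neq0.
have L_gt0 : (0 : R) < L%:R.
  rewrite ltr0n; have [t _|I0] := pickP (fun _ : I => true); last first.
    by move: A_neq0; rewrite /A big1 ?eqxx // => t; have := I0 t.
  apply: leq_trans (collisions t t); apply/card_gt0P; exists (t, t).
  by rewrite inE; apply/forallP => j.
pose lam := Num.sqrt (L%:R * A).
have lam2 : lam ^+ 2 = L%:R * A by rewrite sqr_sqrtr // mulr_ge0 // ltW.
have lam0 : 0 < lam by rewrite sqrtr_gt0 mulr_gt0.
(* This replaces interpolating L2 between L1 and L4 by Hoelder's inequality:
   the cubic [(F - l)^2 (F + 2 l)] is nonnegative. *)
have key : W * A <= lam * \sum_z F z.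
  have : \sum_z 3 * lam ^+ 2 * F z ^+ 2 <= \sum_z (2 * lam ^+ 3 * F z + F z ^+ 4).
    apply: ler_sum => z _; rewrite -subr_ge0.
    have -> : 2 * lam ^+ 3 * F z + F z ^+ 4 - 3 * lam ^+ 2 * F z ^+ 2 =
      F z * ((F z - lam) ^+ 2 * (F z + 2 * lam)) by ring.
    by rewrite mulr_ge0 // mulr_ge0 ?sqr_ge0 // addr_ge0 // mulr_ge0 // ltW.
  rewrite big_split /= -!mulr_sumr m2.
  have {}m4 : \sum_z F z ^+ 4 <= lam ^+ 2 * (W * A).
    by apply: le_trans m4 _; rewrite lam2 le_eqVlt; apply/orP; left; apply/eqP; ring.
  move=> h; have {}h : lam ^+ 2 * (W * A) <= lam ^+ 2 * (lam * \sum_z F z).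
    rewrite [lam ^+ 2 * (lam * _)]mulrA -exprSr; lra.
  by rewrite ler_pM2l ?exprn_gt0 // in h.
have sA : 0 < Num.sqrt A by rewrite sqrtr_gt0.
have key2 : W * Num.sqrt A <= Num.sqrt L%:R * \sum_z F z.
  rewrite -(ler_pM2r sA) -mulrA -expr2 sqr_sqrtr //.
  by apply: le_trans key _; rewrite /lam sqrtrM ?ler0n // mulrAC.
have CS' : \sum_t rnorm (b t) <= Num.sqrt #|I|%:R * Num.sqrt A.
  rewrite -sqrtrM ?ler0n // -[leLHS]ger0_norm ?sumr_ge0 //; last first.
    by move=> t _; apply: rnorm_ge0.
  by rewrite -sqrtr_sqr ler_wsqrtr.
apply: (@le_trans _ _ (W * (Num.sqrt #|I|%:R * Num.sqrt A))).
  by rewrite ler_pM2l.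
rewrite natrM sqrtrM ?ler0n // mulrCA -mulrA.
by rewrite ler_wpM2l ?sqrtr_ge0.
Qed.

End CoefficientSum.

(** * Grothendieck's inequality *)

Lemma le_of_le_geometric (R : realType) (t A B q : R) :
  0 <= q < 1 -> 0 <= B -> (forall n, t <= A + q ^+ n * B) -> t <= A.
Proof.
move=> /andP[q0 q1] B0 h; apply/ler_addgt0Pr => e e0.
have qn : `|q| < 1 by rewrite ger0_norm.
have e1 : 0 < e / (B + 1) by rewrite divr_gt0 // ltr_wpDl.
have /cvgrPdist_lt/(_ _ e1)[N _ /(_ N (leqnn N))] := cvg_expr qn.
rewrite /= sub0r normrN ger0_norm ?exprn_ge0 // ltr_pdivlMr ?ltr_wpDl // => hN.
apply: le_trans (h N) _; rewrite lerD2l; apply: le_trans (ltW hN).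
by rewrite ler_wpM2l ?exprn_ge0 // lerDl.
Qed.

Section Grothendieck.
Variables (R : realType) (I J : finType) (c : I -> J -> R[i]) (S : R).
Notation C := R[i].

(** Vectors are families of coordinates over a finite type [Om], which is not
   fixed: the proof below passes from [Om] to the points of a torus. *)
Definition pairing (Om : finType) (u : I -> Om -> C) (w : J -> Om -> C) : C :=
  \sum_i \sum_j c i j * \sum_o u i o * Num.conj (w j o).

Definition pairing_bound (K : R) : Prop :=
  forall (Om : finType) (u : I -> Om -> C) (w : J -> Om -> C),
    (forall i, \sum_o rnorm (u i o) ^+ 2 <= 1) ->
    (forall j, \sum_o rnorm (w j o) ^+ 2 <= 1) ->
    rnorm (pairing u w) <= K.

Lemma pairing_bound_scaled K a b (Om : finType) (u : I -> Om -> C) (w : J -> Om -> C) :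
  pairing_bound K -> 0 < a -> 0 < b ->
  (forall i, \sum_o rnorm (u i o) ^+ 2 <= a ^+ 2) ->
  (forall j, \sum_o rnorm (w j o) ^+ 2 <= b ^+ 2) ->
  rnorm (pairing u w) <= K * (a * b).
Proof.
move=> HK a0 b0 ua wb.
have ac : realc a != 0 by rewrite -rnorm_eq0 rnormC normr_eq0 gt_eqF.
have bc : realc b != 0 by rewrite -rnorm_eq0 rnormC normr_eq0 gt_eqF.
have scale1 (x : Om -> C) r : 0 < r -> \sum_o rnorm (x o) ^+ 2 <= r ^+ 2 ->
    \sum_o rnorm (x o / realc r) ^+ 2 <= 1.
  move=> r0 xr; rewrite (eq_bigr (fun o => rnorm (x o) ^+ 2 * r ^- 2)).
    by rewrite -mulr_suml ler_pdivrMr ?exprn_gt0 // mul1r.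
  by move=> o _; rewrite rnormM rnormV rnormC gtr0_norm // exprMn exprVn.
have := HK Om (fun i o => u i o / realc a) (fun j o => w j o / realc b)
  (fun i => scale1 _ _ a0 (ua i)) (fun j => scale1 _ _ b0 (wb j)).
suff -> : pairing (fun i o => u i o / realc a) (fun j o => w j o / realc b) =
    pairing u w / realc (a * b).
  rewrite rnormM rnormV rnormC gtr0_norm ?mulr_gt0 //.
  by rewrite ler_pdivrMr ?mulr_gt0.
rewrite /pairing mulr_suml; apply: eq_bigr => i _.
rewrite mulr_suml; apply: eq_bigr => j _.
rewrite -mulrA mulr_suml; congr (_ * _); apply: eq_bigr => o _.
by rewrite rmorphM fmorphV /= conj_real realcM invfM mulrACA.
Qed.

Lemma pairing_bound_trivial : pairing_bound (\sum_i \sum_j rnorm (c i j)).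
Proof.
move=> Om u w u1 w1; apply: le_trans (rnorm_sum _ _ _) _; apply: ler_sum => i _.
apply: le_trans (rnorm_sum _ _ _) _; apply: ler_sum => j _.
rewrite rnormM ler_piMr ?rnorm_ge0 //; apply: le_trans (rnorm_sum _ _ _) _.
apply: (@le_trans _ _ (\sum_o (2^-1 * rnorm (u i o) ^+ 2 + 2^-1 * rnorm (w j o) ^+ 2))).
  apply: ler_sum => o _; rewrite rnormM rnormJ.
  by have := sqr_ge0 (rnorm (u i o) - rnorm (w j o)); lra.
rewrite big_split /= -!mulr_sumr.
by have := u1 i; have := w1 j; lra.
Qed.

Hypothesis c_le : forall x : I -> C, (forall i, rnorm (x i) <= 1) ->
  \sum_j rnorm (\sum_i x i * c i j) <= S.

(** The case of one-dimensional vectors, which is what the hypothesis on the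
   form controls directly. *)
Lemma scalar_form_le a (x : I -> C) (y : J -> C) : 0 < a ->
  (forall i, rnorm (x i) <= a) -> (forall j, rnorm (y j) <= a) ->
  rnorm (\sum_i \sum_j c i j * (x i * Num.conj (y j))) <= a ^+ 2 * S.
Proof.
move=> a0 xa ya; have ac : realc a != 0 by rewrite -rnorm_eq0 rnormC normr_eq0 gt_eqF.
rewrite exchange_big /=; apply: le_trans (rnorm_sum _ _ _) _.
have xa1 i : rnorm (x i / realc a) <= 1.
  by rewrite rnormM rnormV rnormC gtr0_norm // ler_pdivrMr // mul1r.
rewrite expr2 -mulrA; apply: (@le_trans _ _ (a *
   (a * \sum_j rnorm (\sum_i x i / realc a * c i j)))); last first.
  by rewrite !ler_pM2l // c_le.
rewrite !mulr_sumr; apply: ler_sum => j _.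
rewrite (eq_bigr (fun i => (x i / realc a * c i j) * (realc a * Num.conj (y j)))).
  rewrite -mulr_suml !rnormM rnormC rnormJ gtr0_norm // mulrC -mulrA.
  by rewrite ler_pM2l // ler_wpM2r ?rnorm_ge0.
by move=> i _; rewrite -[in LHS](divfK ac (x i)); ring.
Qed.

(** A unit vector [u] is represented by the random sum [F] of its coordinates
   against independent roots of unity of order 3, which preserves inner
   products. Splitting [F] at modulus 5 into a low part [lo] and a high part
   [hi], the pairing of two low parts is a mean of scalar forms bounded by
   [5^2 * S]. As the fourth moment of [F] is at most 4, the high part has L2
   norm at most [2 / 5], so that each of the two remaining pairings is at most
   [2 / 5 * K]. *)
Lemma pairing_bound_step K : pairing_bound K -> pairing_bound (25 * S + 4 / 5 * K).
Proof.
move=> HK Om u w u1 w1.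
have [zeta zetaP] := @exists_prim_root R[i] 3 isT.
pose e (o : Om) : {ffun Om -> nat} := [ffun j => (o == j) : nat].
have e_inj : injective e.
  move=> s t /ffunP/(_ t); rewrite !ffunE eqxx.
  by case: eqP.
have e_small s t j : (e s j + e t j < 3)%N.
  by rewrite !ffunE; case: (_ == _); case: (_ == _).
have e_deg s : (\sum_j e s j = 1)%N.
  rewrite (bigD1 s) //= ffunE eqxx big1 ?addn0 // => j js.
  by rewrite ffunE eq_sym (negPf js).
have e_coll s t : (#|[set st : Om * Om |
    [forall j, (e st.1 j + e st.2 j == e s j + e t j)%N]]| <= 4)%N.
  by apply: (collisions_le_pow e_inj e_small (e_deg s) (e_deg t)).
pose F (x : Om -> C) (z : {ffun Om -> 'I_3}) := mpol e x (torus_pt zeta z).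
pose W : R := (3 ^ #|Om|)%:R; pose s := Num.sqrt W.
have W0 : 0 < W by rewrite ltr0n expn_gt0.
have s0 : 0 < s by rewrite sqrtr_gt0.
have s2 : s ^+ 2 = W by rewrite sqr_sqrtr // ltW.
pose lo x z := if rnorm (F x z) <= 5 then F x z else 0.
pose hi x z := F x z - lo x z.
have F2 x : \sum_o rnorm (x o) ^+ 2 <= 1 -> \sum_z rnorm (F x z) ^+ 2 <= s ^+ 2.
  by move=> x1; rewrite /F (mpol_parseval zetaP e_inj e_small) s2 ler_piMr // ltW.
have lo2 x : \sum_o rnorm (x o) ^+ 2 <= 1 -> \sum_z rnorm (lo x z) ^+ 2 <= s ^+ 2.
  move=> x1; apply: le_trans (F2 x x1); apply: ler_sum => z _; rewrite /lo.
  by case: ifP => // _; rewrite rnorm0 expr0n sqr_ge0.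
have hi2 x : \sum_o rnorm (x o) ^+ 2 <= 1 ->
    \sum_z rnorm (hi x z) ^+ 2 <= (2 / 5 * s) ^+ 2.
  move=> x1; apply: (@le_trans _ _ (\sum_z (25)^-1 * rnorm (F x z) ^+ 4)).
    apply: ler_sum => z _; rewrite /hi /lo; case: (leP (rnorm (F x z)) 5) => [le5|gt5].
      by rewrite subrr rnorm0 expr0n mulr_ge0 ?invr_ge0 // exprn_ge0 ?rnorm_ge0.
    rewrite subr0 (exprM _ 2 2) mulrC ler_pdivlMr //.
    rewrite expr2 ler_wpM2l ?sqr_ge0 //.
    have -> : (25 : R) = 5 ^+ 2 by ring.
    by rewrite lerXn2r ?nnegrE ?rnorm_ge0 // ltW.
  rewrite -mulr_sumr.
  have := mpol_moment4 zetaP e_small e_coll x.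
  rewrite -/(F x) -/W => h; rewrite exprMn s2.
  have x0 : 0 <= \sum_o rnorm (x o) ^+ 2 by apply: sumr_ge0 => o _; apply: sqr_ge0.
  have {}h : \sum_z rnorm (F x z) ^+ 4 <= W * 4.
    apply: le_trans h _; rewrite ler_pM2l // ler_piMr ?ler0n //.
    by rewrite expr_le1.
  by lra.
have lo5 x z : rnorm (lo x z) <= 5.
  by rewrite /lo; case: ifP => // _; rewrite rnorm0.
have split_pairing : realc W * pairing u w =
    (\sum_z \sum_i \sum_j c i j * (lo (u i) z * Num.conj (lo (w j) z))) +
    (pairing (fun i => hi (u i)) (fun j => F (w j)) +
     pairing (fun i => lo (u i)) (fun j => hi (w j))).
  rewrite exchange_big /= mulr_sumr -!big_split /=; apply: eq_bigr => i _.
  rewrite exchange_big /= mulr_sumr -!big_split /=; apply: eq_bigr => j _.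
  rewrite mulrCA realc_nat -(mpol_ortho zetaP e_inj e_small (u i) (w j)).
  rewrite -mulr_sumr -!mulrDr -!big_split; congr (_ * _); apply: eq_bigr => z _ /=.
  by rewrite -/(F _ _) -/(F _ _) /hi rmorphB; ring.
rewrite -(ler_pM2l W0) -{1}[W]gtr0_norm // -rnormC -rnormM split_pairing.
have B1 : rnorm (\sum_z \sum_i \sum_j c i j * (lo (u i) z * Num.conj (lo (w j) z)))
    <= W * (25 * S).
  apply: le_trans (rnorm_sum _ _ _) _.
  apply: (@le_trans _ _ (\sum_(z : {ffun Om -> 'I_3}) 25 * S)).
    apply: ler_sum => z _; have -> : (25 : R) = 5 ^+ 2 by ring.
    by apply: scalar_form_le.
  by rewrite sumr_const card_ffun card_ord -[leLHS]mulr_natl.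
have B2 : rnorm (pairing (fun i => hi (u i)) (fun j => F (w j))) <= K * (2 / 5 * s * s).
  by apply: pairing_bound_scaled => // [|i|j]; [rewrite mulr_gt0 | apply: hi2 | apply: F2].
have B3 : rnorm (pairing (fun i => lo (u i)) (fun j => hi (w j))) <= K * (s * (2 / 5 * s)).
  by apply: pairing_bound_scaled => // [|i|j]; [rewrite mulr_gt0 | apply: lo2 | apply: hi2].
apply: le_trans (rnormD _ _) _; apply: le_trans (lerD B1 (rnormD _ _)) _.
apply: le_trans (lerD (lexx _) (lerD B2 B3)) _; rewrite le_eqVlt; apply/orP; left.
by apply/eqP; rewrite -s2; field.
Qed.

(** The step contracts by the factor [4 / 5] towards its fixed point
   [25 S / (1 - 4 / 5)]; any bound is a valid starting point. *)
Lemma grothendieck : pairing_bound (125 * S).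
Proof.
pose K0 := \sum_i \sum_j rnorm (c i j).
have iter n : pairing_bound (125 * S + (4 / 5) ^+ n * K0).
  elim: n => [|n IHn] Om u w u1 w1.
    rewrite expr0 mul1r; apply: le_trans (pairing_bound_trivial u1 w1) _.
    rewrite lerDr mulr_ge0 //; have := @c_le (fun=> 0) _.
    rewrite rnorm0 => /(_ (fun=> ler01)); apply: le_trans.
    by apply: sumr_ge0 => j _; apply: rnorm_ge0.
  apply: le_trans (pairing_bound_step IHn u1 w1) _.
  by rewrite exprS; lra.
move=> Om u w u1 w1; apply: (@le_of_le_geometric _ _ _ K0 (4 / 5)).
- by apply/andP; split; lra.
- by do 2![apply: sumr_ge0 => ? _]; apply: rnorm_ge0.
- by move=> n; apply: iter.
Qed.

End Grothendieck.

(** * Vectors and functionals of a Hilbert space *)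

Section Hilbert.
Variables (R : realType) (H : hilbert R).
Notation C := R[i].
Implicit Types (x y g : H).

Lemma innerJ x y : inner H x y = Num.conj (inner H y x).
Proof. by rewrite hermC expr0 mul1r. Qed.

Lemma inner_sqr x : inner H x x = realc (rnorm x ^+ 2).
Proof. by rewrite -inner_norm realcX rnormE. Qed.

Lemma inner_ge0 x : 0 <= inner H x x.
Proof. by rewrite inner_sqr -[0]/(realc 0) realc_le sqr_ge0. Qed.

Lemma inner_suml (I : finType) (F : I -> H) y :
  inner H (\sum_i F i) y = \sum_i inner H (F i) y.
Proof. exact: linear_sumlz. Qed.

Lemma inner_sumr (I : finType) (F : I -> H) y :
  inner H y (\sum_i F i) = \sum_i inner H y (F i).
Proof. exact: linear_sumr. Qed.

Lemma innerZl a x y : inner H (a *: x) y = a * inner H x y.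
Proof. exact: linearZl_LR. Qed.

Lemma innerZr a x y : inner H x (a *: y) = Num.conj a * inner H x y.
Proof. exact: linearZr_LR. Qed.

Lemma cauchy_schwarz x g : rnorm (inner H x g) <= rnorm x * rnorm g.
Proof.
have [->|g0] := eqVneq g 0.
  by rewrite linear0r rnorm0 mulr_ge0 // rnorm_ge0.
pose n := inner H g g; pose t := inner H x g.
have nJ : Num.conj n = n by rewrite /n inner_sqr conj_real.
have g_gt0 : 0 < rnorm g by rewrite lt_def rnorm_ge0 rnorm_eq0 g0.
have := inner_ge0 (n *: x - t *: g).
rewrite linearBl !linearBr /= !innerZl !innerZr nJ.
rewrite (innerJ g x) -/t -/n.
have -> : n * (n * inner H x x) - n * (Num.conj t * t) -
    (t * (n * Num.conj t) - t * (Num.conj t * n)) =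
    realc (rnorm g ^+ 2 * (rnorm g ^+ 2 * rnorm x ^+ 2 - rnorm t ^+ 2)).
  rewrite realcM -inner_sqr -/n.
  have -> : realc (rnorm g ^+ 2 * rnorm x ^+ 2 - rnorm t ^+ 2) =
     n * inner H x x - t * Num.conj t.
    by rewrite /n !inner_sqr -realcM -rnorm_sqr /realc -rmorphB.
  by ring.
rewrite -[0]/(realc 0) realc_le pmulr_rge0 ?exprn_gt0 // subr_ge0 -exprMn mulrC.
by rewrite ler_pXn2r ?nnegrE ?mulr_ge0 ?rnorm_ge0.
Qed.

Definition orthonormal_family (Om : finType) (e : Om -> H) : Prop :=
  forall a b, inner H (e a) (e b) = (a == b)%:R.

Lemma orthonormal_inner (Om : finType) (e : Om -> H) (F : Om -> C) b :
  orthonormal_family e -> inner H (\sum_a F a *: e a) (e b) = F b.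
Proof.
move=> eo; rewrite inner_suml (bigD1 b) //= innerZl eo eqxx mulr1.
by rewrite big1 ?addr0 // => a ab; rewrite innerZl eo (negPf ab) mulr0.
Qed.

Lemma orthonormal_sqr (Om : finType) (e : Om -> H) (F : Om -> C) :
  orthonormal_family e ->
  rnorm (\sum_a F a *: e a) ^+ 2 = \sum_a rnorm (F a) ^+ 2.
Proof.
move=> eo; apply: (@realcI R); rewrite -inner_sqr realc_sum inner_sumr.
apply: eq_bigr => b _; rewrite innerZr orthonormal_inner //.
by rewrite rnorm_sqr mulrC.
Qed.

(** Orthonormalising finitely many vectors gives them coordinates in which
   norms and inner products are those of a finite sum. *)
Lemma gram_schmidt (s : seq H) : exists (Om : finType) (e : Om -> H),
  orthonormal_family e /\
  forall v, v \in s -> v = \sum_a inner H v (e a) *: e a.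
Proof.
elim: s => [|v s [Om [e [eo es]]]].
  by exists void, (fun a : void => match a with end); split => [[]|].
pose v' := v - \sum_a inner H v (e a) *: e a.
have v'e b : inner H v' (e b) = 0.
  by rewrite linearBl /= orthonormal_inner // subrr.
have [v'0|v'0] := eqVneq v' 0.
  exists Om, e; split => // w; rewrite inE => /orP[/eqP ->|/es //].
  by apply/eqP; rewrite -subr_eq0 -/v' v'0.
have v'n : realc (rnorm v') != 0 by rewrite -rnorm_eq0 rnormC normr_eq0 rnorm_eq0.
pose f (a : Om + unit) := if a is inl b then e b else (realc (rnorm v'))^-1 *: v'.
have conjV : Num.conj (realc (rnorm v'))^-1 = (realc (rnorm v'))^-1.
  by rewrite -realcV conj_real.
exists (Om + unit)%type, f; split.
  move=> [a|[]] [b|[]] /=; rewrite ?eo ?innerZl ?innerZr //.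
  - by rewrite innerJ v'e rmorph0 mulr0.
  - by rewrite v'e mulr0.
  by rewrite conjV inner_sqr realcX; field.
have sum_f (w : H) : \sum_a inner H w (f a) *: f a =
    \sum_a inner H w (e a) *: e a + (realc (rnorm v')) ^- 2 * inner H w v' *: v'.
  rewrite big_sumType /= (bigD1 tt) //= [X in _ + (_ + X)]big1 ?addr0; last by case.
  by congr (_ + _); rewrite innerZr conjV scalerA; congr (_ *: _); field.
move=> w; rewrite inE sum_f => /orP[/eqP -> | ws].
  have -> : inner H v v' = realc (rnorm v' ^+ 2).
    rewrite -inner_sqr {2}/v' linearBl /= inner_suml big1 ?subr0 // => a _.
    by rewrite innerZl (innerJ (e a)) v'e rmorph0 mulr0.
  by rewrite realcX mulVf ?expf_neq0 // scale1r /v' addrC subrK.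
rewrite -es //; have -> : inner H w v' = 0.
  rewrite (es w ws) inner_suml big1 // => a _.
  by rewrite innerZl (innerJ (e a)) v'e rmorph0 mulr0.
by rewrite mulr0 scale0r addr0.
Qed.

(** Bessel's inequality for the functional [<A x, g>]: it is evaluated at the sum [y] of the [e a] weighted by the
   conjugates of its values. The value there is [s = |y|^2], and it is at most
   [|y|], so [|y| <= 1]. *)
Lemma sum_functional_sqr_le (Om : finType) (e : Om -> H) (A : {linear H -> H}) g :
  orthonormal_family e -> (forall x, rnorm (A x) <= rnorm x) -> rnorm g <= 1 ->
  \sum_a rnorm (inner H (A (e a)) g) ^+ 2 <= 1.
Proof.
move=> eo A1 g1; set s := \sum_a _.
pose y := \sum_a Num.conj (inner H (A (e a)) g) *: e a.
have s0 : 0 <= s by apply: sumr_ge0 => a _; apply: sqr_ge0.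
have ys : rnorm y ^+ 2 = s.
  by rewrite orthonormal_sqr //; apply: eq_bigr => a _; rewrite rnormJ.
have sE : inner H (A y) g = realc s.
  rewrite linear_sum inner_suml realc_sum; apply: eq_bigr => a _.
  by rewrite linearZ innerZl rnorm_sqr mulrC.
have sy : s <= rnorm y.
  rewrite -[s]ger0_norm // -rnormC -sE; apply: le_trans (cauchy_schwarz _ _) _.
  by apply: le_trans (A1 y); rewrite ler_piMr ?rnorm_ge0.
have y1 : rnorm y <= 1.
  have [y0|y0] := eqVneq (rnorm y) 0; first by rewrite y0 ler01.
  have y_gt0 : 0 < rnorm y by rewrite lt_def y0 rnorm_ge0.
  by rewrite -(ler_pM2l y_gt0) mulr1 -expr2 ys.
by apply: le_trans sy y1.
Qed.

Lemma grothendieck_functionals (I J : finType) (c : I -> J -> C) (S : R)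
    (u : J -> H) (A : I -> {linear H -> H}) g :
  (forall x : I -> C, (forall i, rnorm (x i) <= 1) ->
    \sum_j rnorm (\sum_i x i * c i j) <= S) ->
  (forall j, rnorm (u j) <= 1) ->
  (forall i x, rnorm (A i x) <= rnorm x) -> rnorm g <= 1 ->
  rnorm (\sum_i \sum_j c i j * inner H (A i (u j)) g) <= 125 * S.
Proof.
move=> c_le u1 A1 g1.
have [Om [e [eo es]]] := gram_schmidt (codom u).
have {}es j : u j = \sum_a inner H (u j) (e a) *: e a by apply/es/codom_f.
pose fu i a := inner H (A i (e a)) g.
pose w j a := Num.conj (inner H (u j) (e a)).
have fu1 i : \sum_a rnorm (fu i a) ^+ 2 <= 1 by apply: sum_functional_sqr_le.
have w1 j : \sum_a rnorm (w j a) ^+ 2 <= 1.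
  under eq_bigr do rewrite rnormJ.
  by rewrite -(orthonormal_sqr _ eo) -es expr_le1 ?rnorm_ge0.
have := grothendieck c_le fu1 w1.
congr (rnorm _ <= _); apply: eq_bigr => i _; apply: eq_bigr => j _; congr (_ * _).
rewrite [in RHS]es linear_sum inner_suml; apply: eq_bigr => a _.
by rewrite linearZ innerZl /w conjCK mulrC.
Qed.

End Hilbert.

(** * Directional derivatives of polynomials *)

(** Identities between ring morphisms and derivations on polynomials need only
   be checked on constants and variables. *)
Lemma mpoly_ring_ind (d : nat) (A : comNzRingType) (P : mpoly d A -> Prop) :
  (forall a, P (mpolyC d a)) -> (forall i, P (mpolyX A (mnm1 i))) ->
  (forall p q, P p -> P q -> P (p + q)) ->
  (forall p q, P p -> P q -> P (p * q)) -> forall p, P p.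
Proof.
move=> PC PX PD PM; elim/mpolyind => [|a m p _ _ Pp].
  by rewrite -(mpolyC0 d A); apply: (PC).
apply: (PD) => //; rewrite -mul_mpolyC; apply: (PM); first exact: (PC).
rewrite mpolyXE_id; apply: (big_ind P) => [||i _].
- by rewrite -(mpolyC1 d A); apply: (PC).
- exact: (PM).
elim: (m i) => [|n IHn]; first by rewrite expr0 -(mpolyC1 d A); apply: (PC).
by rewrite exprS; apply: (PM).
Qed.

Section Derivative.
Variables (R : rcfType) (d : nat).
Notation C := R[i].
Implicit Types (p q : mpoly d C) (z x y v : 'I_d -> C).

(** The univariate polynomial [t |-> p (z + t x)]. *)
Definition restrict_line z x p : {poly C} :=
  mmap polyC (fun i => (z i)%:P + x i *: 'X) p.

Lemma horner_restrict_line z x p t :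
  (restrict_line z x p).[t] = meval (fun i => z i + t * x i) p.
Proof.
elim/mpoly_ring_ind: p => [a|i|p q hp hq|p q hp hq].
- by rewrite /restrict_line mmapC mevalC hornerC.
- by rewrite /restrict_line mmapX mmap1U mevalXU !hornerE mulrC.
- by rewrite mevalD -hp -hq -hornerD /restrict_line mmapD.
by rewrite mevalM -hp -hq -hornerM /restrict_line rmorphM.
Qed.

Definition dir_deriv x p : mpoly d C := \sum_i x i *: mderiv i p.

Lemma meval_dir_deriv x z p :
  meval z (dir_deriv x p) = \sum_i x i * meval z (mderiv i p).
Proof. by rewrite /dir_deriv raddf_sum; apply: eq_bigr => i _ /=; rewrite mevalZ. Qed.

Lemma coef1_restrict_line z x p :
  (restrict_line z x p)`_1 = meval z (dir_deriv x p).
Proof.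
have at0 q : (restrict_line z x q)`_0 = meval z q.
  rewrite -horner_coef0 horner_restrict_line; apply: meval_eq => i.
  by rewrite mul0r addr0.
rewrite meval_dir_deriv; elim/mpoly_ring_ind: p => [a|i|p q hp hq|p q hp hq].
- rewrite /restrict_line mmapC coefC big1 // => i _.
  by rewrite mderivC meval0 mulr0.
- rewrite /restrict_line mmapX mmap1U coefD coefC coefZ coefX add0r mulr1.
  rewrite (bigD1 i) //= big1 ?addr0 => [|j ji].
    rewrite mderivX mnm1E eqxx scale1r mevalX big1 ?mulr1 // => j _.
    by rewrite mnmBE subnn expr0.
  by rewrite mderivX mnm1E eq_sym (negPf ji) scale0r meval0 mulr0.
- rewrite /restrict_line mmapD coefD hp hq -big_split; apply: eq_bigr => i _ /=.
  by rewrite mderivD mevalD mulrDr.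
rewrite /restrict_line rmorphM /= coefM !big_ord_recl big_ord0 /= addr0 !at0 hp hq.
rewrite mulr_sumr mulr_suml addrC -big_split; apply: eq_bigr => i _ /=.
by rewrite mderivM mevalD !mevalM; ring.
Qed.

(** Cauchy's estimate for the linear coefficient, with the circle of radius [r]
   replaced by roots of unity of an order exceeding the degree. *)
Lemma coef1_le (P : {poly C}) (r B : R) : 0 < r ->
  (forall t, rnorm t = r -> rnorm P.[t] <= B) -> rnorm P`_1 <= B / r.
Proof.
move=> r0 PB; pose Q := maxn 2 (size P).
have Q0 : (0 < Q)%N by rewrite leq_max.
have Q1 : (1 < Q)%N by rewrite leq_max.
have [zeta zetaP] := exists_prim_root C Q0.
have z1 (i : nat) : rnorm (zeta ^+ i) = 1.
  have h := prim_expr_order zetaP.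
  have /eqP : rnorm zeta ^+ Q = 1 by rewrite -rnormX h rnorm1.
  rewrite pexpr_eq1 ?rnorm_ge0 // => /eqP z1.
  by rewrite rnormX z1 expr1n.
have cauchy : \sum_(i < Q) P.[realc r * zeta ^+ i] * Num.conj ((zeta ^+ i) ^+ 1) =
    realc (Q%:R * r) * P`_1.
  rewrite (eq_bigr (fun i : 'I_Q => \sum_(a < Q) (P`_a * realc r ^+ a) *
     ((zeta ^+ i) ^+ a * Num.conj ((zeta ^+ i) ^+ 1)))); last first.
    move=> i _; rewrite (@horner_coef_wide _ Q) ?leq_maxr // mulr_suml.
    by apply: eq_bigr => a _; rewrite exprMn !mulrA.
  rewrite exchange_big /= (bigD1 (Ordinal Q1)) //= [X in _ + X]big1 ?addr0.
    by rewrite -mulr_sumr (prim_root_ortho zetaP) // eqxx muln1 realcM realc_nat; ring.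
  move=> a a1; rewrite -mulr_sumr (prim_root_ortho zetaP) //.
  by rewrite -[(_ == _)]/(a == Ordinal Q1) (negPf a1) muln0 mulr0.
have QR0 : (0 : R) < Q%:R by rewrite ltr0n.
rewrite ler_pdivlMr // -(ler_pM2l QR0).
have -> : Q%:R * (rnorm P`_1 * r) = rnorm (realc (Q%:R * r) * P`_1).
  by rewrite rnormM rnormC gtr0_norm ?mulr_gt0 // -mulrA [r * _]mulrC.
rewrite -cauchy; apply: le_trans (rnorm_sum _ _ _) _.
apply: (@le_trans _ _ (\sum_(i < Q) B)); last first.
  by rewrite sumr_const card_ord -[leLHS]mulr_natl.
apply: ler_sum => i _; rewrite rnormM rnormJ expr1 z1 mulr1 PB //.
by rewrite rnormM rnormC gtr0_norm // z1 mulr1.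
Qed.

Lemma dir_deriv_le p (rho r B : R) x z : 0 < r ->
  (forall v, (forall j, rnorm (v j) < rho + r) -> rnorm (meval v p) <= B) ->
  (forall j, rnorm (x j) <= 1) -> (forall j, rnorm (z j) < rho) ->
  rnorm (meval z (dir_deriv x p)) <= B / r.
Proof.
move=> r0 pB x1 zrho; rewrite -coef1_restrict_line; apply: coef1_le => // t tr.
rewrite horner_restrict_line; apply: pB => j.
apply: le_lt_trans (rnormD _ _) _; rewrite ltr_leD // rnormM tr.
by rewrite ler_piMr // ltW.
Qed.

(** Weights [y] of modulus at most 1 turn the sum of moduli into the second directional
   derivative of [p] along [x] and [y]; Cauchy's estimate applies twice. *)
Lemma sum_dir_deriv2_le p (rho r B : R) x z : 0 < r ->
  (forall v, (forall j, rnorm (v j) < rho + r + r) -> rnorm (meval v p) <= B) ->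
  (forall j, rnorm (x j) <= 1) -> (forall j, rnorm (z j) < rho) ->
  \sum_j rnorm (meval z (mderiv j (dir_deriv x p))) <= B / r / r.
Proof.
move=> r0 pB x1 zrho.
pose phase j := rnorm_phase (meval z (mderiv j (dir_deriv x p))).
pose y j := s2val (cid2 (phase j)).
have y1 j : rnorm (y j) <= 1 by rewrite /y; case: cid2.
have yE j : y j * meval z (mderiv j (dir_deriv x p)) =
    realc (rnorm (meval z (mderiv j (dir_deriv x p)))).
  by rewrite /y; case: cid2.
set s := \sum_j _; have s0 : 0 <= s by apply: sumr_ge0 => j _; apply: rnorm_ge0.
have -> : s = rnorm (meval z (dir_deriv y (dir_deriv x p))).
  rewrite meval_dir_deriv -[LHS]ger0_norm // -rnormC realc_sum; congr rnorm.
  by apply: eq_bigr => j _; rewrite yE.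
apply: (dir_deriv_le r0) y1 zrho => v vr.
exact: (dir_deriv_le r0 pB x1 vr).
Qed.

Lemma meval_homog_scale k p (a : C) v : p \is ishomog1 k mdeg ->
  meval (fun j => a * v j) p = a ^+ k * meval v p.
Proof.
move=> /dhomogP hp; rewrite !mevalE mulr_sumr; apply: eq_big_seq => m mp.
under eq_bigr do rewrite exprMn.
rewrite big_split /= prodrXr -mdegE hp //; ring.
Qed.

Lemma meval_homog_le k p (M rho : R) : p \is ishomog1 k mdeg -> 0 < rho ->
  (forall v, (forall j, rnorm (v j) < 1) -> rnorm (meval v p) <= M) ->
  forall v, (forall j, rnorm (v j) < rho) -> rnorm (meval v p) <= rho ^+ k * M.
Proof.
move=> hp rho0 pM v vr.
have rc : realc rho != 0 by rewrite -rnorm_eq0 rnormC normr_eq0 gt_eqF.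
have -> : meval v p = realc rho ^+ k * meval (fun j => v j / realc rho) p.
  rewrite -meval_homog_scale //; apply: meval_eq => j; rewrite mulrC divfK //.
rewrite rnormM rnormX rnormC gtr0_norm // ler_pM2l ?exprn_gt0 //.
apply: pM => j; rewrite rnormM rnormV rnormC gtr0_norm //.
by rewrite ltr_pdivrMr // mul1r.
Qed.

Lemma mderiv_homog k p i : p \is ishomog1 k.+1 mdeg ->
  mderiv i p \is ishomog1 k mdeg.
Proof.
move=> hp; apply/dhomogP => m; rewrite mcoeff_msupp mcoeff_mderiv => h.
have : mcoeff (mnm_add m (mnm1 i)) p != 0.
  by apply: contraNneq h => ->; rewrite mul0rn.
rewrite -mcoeff_msupp => /(dhomogP _ _ _ hp).
by rewrite /= mdegD mdeg1 addn1 => -[].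
Qed.

End Derivative.

(** * Sums over multi-indices *)

Lemma big_seq_support (V : zmodType) (T : eqType) (s1 s2 : seq T) (G : T -> V) :
  uniq s1 -> uniq s2 -> {subset s1 <= s2} ->
  (forall m, m \notin s1 -> G m = 0) ->
  \sum_(m <- s1) G m = \sum_(m <- s2) G m.
Proof.
move=> u1 u2 s12 G0; rewrite [RHS](bigID (mem s1)) /= [X in _ = _ + X]big1 //=.
rewrite addr0 -[RHS]big_filter; apply: perm_big; apply: uniq_perm => //.
  exact: filter_uniq.
by move=> m; rewrite mem_filter; case: (boolP (m \in s1)) => // /s12 ->.
Qed.

Section MultiIndices.
Variables (d n : nat).

(** The multi-indices of degree [n] in [d] variables. *)
Definition midx : Type :=
  {t : {ffun 'I_d -> 'I_n.+1} | (\sum_j t j == n)%N}.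
HB.instance Definition _ := Finite.on midx.

Definition midx_ffun (t : midx) : {ffun 'I_d -> nat} := [ffun j => val (val t j)].

Definition midx_mnm (t : midx) : multinom d := Multinom (mktuple (midx_ffun t)).

Lemma midx_mnmE t j : midx_mnm t j = midx_ffun t j.
Proof. by rewrite mnm_tnth tnth_mktuple. Qed.

Lemma midx_ffun_inj : injective midx_ffun.
Proof.
move=> s t /ffunP st; apply: val_inj; apply/ffunP => j; apply: val_inj.
by have := st j; rewrite !ffunE.
Qed.

Lemma midx_mnm_inj : injective midx_mnm.
Proof.
move=> s t st; apply: midx_ffun_inj; apply/ffunP => j.
by rewrite -!midx_mnmE st.
Qed.

Lemma midx_ffun_le t j : (midx_ffun t j <= n)%N.
Proof. by rewrite ffunE -ltnS; apply: ltn_ord. Qed.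

Lemma midx_ffun_sum t : (\sum_j midx_ffun t j = n)%N.
Proof. by under eq_bigr do rewrite ffunE; exact/eqP/(valP t). Qed.

Lemma midx_mnm_surj m : mdeg m = n -> exists t, midx_mnm t = m.
Proof.
move=> mn; have mle j : (m j < n.+1)%N.
  by rewrite ltnS -mn mdegE (bigD1 j) //= leq_addr.
pose t : {ffun 'I_d -> 'I_n.+1} := [ffun j => Ordinal (mle j)].
have tn : (\sum_j t j == n)%N.
  by rewrite -[X in _ == X]mn mdegE; apply/eqP/eq_bigr => j _; rewrite ffunE.
by exists (exist _ t tn); apply/mnmP => j; rewrite midx_mnmE !ffunE.
Qed.

Lemma sum_msupp_midx (A : nzRingType) (V : zmodType) (p : mpoly d A)
    (G : multinom d -> V) :
  p \is ishomog1 n mdeg -> (forall m, mcoeff m p = 0 -> G m = 0) ->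
  \sum_(m <- msupp p) G m = \sum_t G (midx_mnm t).
Proof.
move=> hp G0; rewrite (@big_seq_support _ _ _ (map midx_mnm (enum {: midx}))) ?msupp_uniq //.
- by rewrite big_map big_enum.
- by rewrite map_inj_uniq ?enum_uniq //; apply: midx_mnm_inj.
- move=> m /(dhomogP _ _ _ hp)/midx_mnm_surj[t <-].
  by apply: map_f; rewrite mem_enum.
by move=> m mp; apply: G0; apply: memN_msupp_eq0.
Qed.

End MultiIndices.

Lemma card_midx d n : (#|{: midx d.+1 n}| = 'C(d + n, d))%N.
Proof.
rewrite -card_ord_partitions; apply/eqP; rewrite eqn_leq; apply/andP; split.
  pose f (t : midx d.+1 n) : d.+1.-tuple 'I_n.+1 := mktuple (val t).
  rewrite -(card_imset (f := f)); last first.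
    move=> s t st; apply: val_inj; apply/ffunP => j.
    by rewrite -(tnth_mktuple (val s)) -(tnth_mktuple (val t)) -/(f s) st.
  apply: subset_leq_card; apply/fintype.subsetP => _ /imsetP[t _ ->].
  rewrite inE big_tuple; under eq_bigr do rewrite tnth_mktuple.
  exact: (valP t).
rewrite card_sig; pose g (t : d.+1.-tuple 'I_n.+1) := [ffun j => tnth t j].
rewrite -(card_imset (f := g)); last first.
  move=> s t /ffunP st; apply: eq_from_tnth => j.
  by have := st j; rewrite !ffunE.
apply: subset_leq_card; apply/fintype.subsetP => _ /imsetP[t tn ->].
rewrite inE; move: tn; rewrite inE big_tuple => /eqP tn.
by apply/eqP; rewrite -[RHS]tn; apply: eq_bigr => j _; rewrite ffunE.
Qed.

(** The quotient of ['C(d + n, d)] by [d.+1 ^ n] decreases in [d], since the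
   factor [(d + 1 + n) / ((n + 1) (d + 1))] gained from [n] to [n + 1] does. *)
Lemma card_midx_pow b d n : (b < d.+1)%N ->
  (b.+1 ^ n * 'C(d + n, d) <= 'C(b + n, b) * d.+1 ^ n)%N.
Proof.
move=> bd; elim: n => [|n IHn]; first by rewrite !addn0 !binn !expn0.
have step e : (n.+1 * 'C(e + n.+1, e) = (e.+1 + n) * 'C(e + n, e))%N.
  have bin_e l : 'C(e + l, e) = 'C(e + l, l).
    by rewrite -[RHS]bin_sub ?leq_addl // addnK.
  by rewrite !bin_e addSn [in LHS]addnS -mul_bin_diag.
rewrite -(leq_pmul2l (ltn0Sn n)) !expnS.
rewrite mulnCA step [leqRHS]mulnA step.
rewrite (_ : b.+1 * b.+1 ^ n * _ = (b.+1 * (d.+1 + n)) * (b.+1 ^ n * 'C(d + n, d)))%N; last by ring.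
rewrite (_ : (b.+1 + n) * _ * _ = (d.+1 * (b.+1 + n)) * ('C(b + n, b) * d.+1 ^ n))%N; last by ring.
apply: leq_mul => //; rewrite !mulnDr mulnC leq_add2l leq_mul2r.
by rewrite bd orbT.
Qed.

(** * Evaluating polynomials at commuting operators *)

Section Euler.
Variables (A : comNzRingType) (d : nat) (V : lmodType A).
Implicit Types (p : mpoly d A) (F : multinom d -> V).

Definition monomial_sum F p : V := \sum_(m <- msupp p) mcoeff m p *: F m.

Lemma monomial_sum_wide F p (s : seq (multinom d)) : uniq s ->
  {subset msupp p <= s} -> monomial_sum F p = \sum_(m <- s) mcoeff m p *: F m.
Proof.
move=> us ps; apply: big_seq_support => // m /memN_msupp_eq0 ->.
by rewrite scale0r.
Qed.

Lemma monomial_sum_is_linear F : linear (monomial_sum F).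
Proof.
move=> a p q; pose s := undup (msupp (a *: p + q) ++ msupp p ++ msupp q).
have us : uniq s by apply: undup_uniq.
rewrite (@monomial_sum_wide F _ s) => [|//|m]; last first.
  by rewrite mem_undup !mem_cat => ->.
rewrite (@monomial_sum_wide F p s) => [|//|m]; last first.
  by rewrite mem_undup !mem_cat => ->; rewrite orbT.
rewrite (@monomial_sum_wide F q s) => [|//|m]; last first.
  by rewrite mem_undup !mem_cat => ->; rewrite !orbT.
rewrite scaler_sumr -big_split; apply: eq_bigr => m _ /=.
by rewrite mcoeffD mcoeffZ scalerDl scalerA.
Qed.

HB.instance Definition _ F :=
  GRing.isLinear.Build A (mpoly d A) V *:%R (monomial_sum F)
    (monomial_sum_is_linear F).

Lemma monomial_sumX F m : monomial_sum F (mpolyX A m) = F m.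
Proof. by rewrite /monomial_sum msuppX big_seq1 mcoeffX eqxx scale1r. Qed.

(** Euler's identity with a vector [F m] substituted for each monomial;
   multiplying by the variable [i] becomes the shift of the exponent by
   [mnm1 i]. *)
Lemma monomial_sum_euler F p :
  \sum_i monomial_sum (fun m => F (mnm_add m (mnm1 i))) (mderiv i p) =
  monomial_sum (fun m => (mdeg m)%:R *: F m) p.
Proof.
elim/mpolyind: p => [|a m p _ _ IHp].
  by rewrite linear0 big1 // => i _; rewrite mderiv0 linear0.
rewrite [RHS]linearP /= monomial_sumX -IHp.
under eq_bigr do rewrite linearP /= linearP /= mderivX linearZ /= monomial_sumX.
rewrite big_split /= -scaler_sumr; congr (_ *: _ + _).
rewrite mdegE natr_sum scaler_suml; apply: eq_bigr => i _.
have [->|mi] := eqVneq (m i) 0%N; first by rewrite !scale0r.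
congr (_ *: F _); apply/mnmP => j; rewrite mnmDE mnmBE mnm1E.
by case: eqP => [<-|_]; rewrite ?subn0 ?addn0 // subnK // lt0n.
Qed.

Lemma monomial_sum_euler_homog k F p : p \is ishomog1 k mdeg ->
  k%:R *: monomial_sum F p =
  \sum_i monomial_sum (fun m => F (mnm_add m (mnm1 i))) (mderiv i p).
Proof.
move=> hp; rewrite monomial_sum_euler /monomial_sum scaler_sumr.
by apply: eq_big_seq => m /(dhomogP _ _ _ hp) <-; rewrite !scalerA mulrC.
Qed.

End Euler.

Section OperatorMonomials.
Variables (R : realType) (H : hilbert R) (d : nat) (T : 'I_d -> {linear H -> H}).
Hypothesis commT : forall i j, T i \o T j = T j \o T i :> (H -> H).

Definition op_monomial (m : multinom d) : H -> H :=
  \big[@comp H H H/id]_(j < d) iter (m j) (T j).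

(** The factors of [op_monomial] are composed in a fixed order; commutation
   moves the extra factor [T i] through those that precede it. *)
Lemma op_monomialM m i x :
  op_monomial (mnm_add m (mnm1 i)) x = T i (op_monomial m x).
Proof.
pose G (m : multinom d) s : H -> H := \big[@comp H H H/id]_(j <- s) iter (m j) (T j).
have TiterC j k y : T i (iter k (T j) y) = iter k (T j) (T i y).
  elim: k => //= k <-.
  by have := congr1 (fun f => f (iter k (T j) y)) (commT i j).
have Gnotin s y : i \notin s -> G (mnm_add m (mnm1 i)) s y = G m s y.
  elim: s y => [|j s IHs] y; first by rewrite /G !big_nil.
  rewrite inE negb_or => /andP[ij /IHs e]; rewrite /G !big_cons /= -!/(G _ s) e.
  by rewrite mnmDE mnm1E (negPf ij) addn0.
have Gin s y : uniq s -> i \in s -> G (mnm_add m (mnm1 i)) s y = T i (G m s y).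
  elim: s y => [//|j s IHs] y /= /andP[js us]; rewrite inE /G !big_cons /= -!/(G _ s).
  rewrite mnmDE mnm1E; case: (eqVneq i j) js => [<-|ij] js /= => [_|/(IHs y us) ->].
    by rewrite Gnotin // addn1.
  by rewrite addn0 -TiterC.
by apply: Gin; rewrite ?index_enum_uniq ?mem_index_enum.
Qed.

Lemma op_monomial_le m x : (forall j y, rnorm (T j y) <= rnorm y) ->
  rnorm (op_monomial m x) <= rnorm x.
Proof.
move=> T1; rewrite /op_monomial.
elim/big_rec: _ x => [//|j f _ IHf] x /=; apply: le_trans (IHf x).
elim: (m j) => //= k; apply: le_trans; exact: T1.
Qed.

End OperatorMonomials.

(** * The operator bound *)

Lemma meval_mpol (R : rcfType) (d n : nat) (p : mpoly d R[i]) (v : 'I_d -> R[i]) :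
  p \is ishomog1 n mdeg ->
  meval v p = mpol (@midx_ffun d n) (fun t => mcoeff (midx_mnm t) p) v.
Proof.
move=> hp; rewrite mevalE (sum_msupp_midx hp); last by move=> m ->; rewrite mul0r.
apply: eq_bigr => t _; congr (_ * _); apply: eq_bigr => j _.
by rewrite midx_mnmE.
Qed.

Lemma midx_ffun_small (d n : nat) (s t : midx d n) j :
  (midx_ffun s j + midx_ffun t j < (n + n).+1)%N.
Proof. by rewrite ltnS leq_add // midx_ffun_le. Qed.

Lemma midx_collisions (d n : nat) (s t : midx d n) :
  (#|[set st : midx d n * midx d n | [forall j,
     (midx_ffun st.1 j + midx_ffun st.2 j == midx_ffun s j + midx_ffun t j)%N]]|
   <= minn #|{: midx d n}| (4 ^ n))%N.
Proof.
rewrite leq_min (collisions_le_card (@midx_ffun_inj d n)).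
by rewrite (collisions_le_pow (@midx_ffun_inj d n) (@midx_ffun_small d n)) //;
  apply: midx_ffun_sum.
Qed.

Section OperatorBound.
Variables (R : realType) (d n : nat) (p : mpoly d R[i]) (M : R).
Notation C := R[i].
Hypothesis hp : p \is ishomog1 n.+2 mdeg.
Hypothesis pM : forall v : 'I_d -> C,
  (forall j, rnorm (v j) < 1) -> rnorm (meval v p) <= M.

Let M0 : 0 <= M.
Proof.
apply: le_trans (rnorm_ge0 _) (pM (v := fun=> 0) _) => j.
by rewrite rnorm0 ltr01.
Qed.

Let k : R := n.+2%:R.
Let k0 : 0 < k. Proof. by rewrite ltr0n. Qed.

(** Homogeneity controls [p] on the polydisc of radius [1 + 3 / k], at the cost
   of a factor [(1 + 3 / k)^k <= e^3]. One [1 / k] moves past the closed unit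
   polydisc and the other two are the radii of the two Cauchy estimates. *)
Lemma meval_expanded_le v : (forall j, rnorm (v j) < 1 + k^-1 + k^-1 + k^-1) ->
  rnorm (meval v p) <= expR 3 * M.
Proof.
move=> vr; have rho0 : 0 < 1 + k^-1 + k^-1 + k^-1.
  by rewrite !addr_gt0 ?invr_gt0.
apply: le_trans (meval_homog_le hp rho0 pM vr) _.
rewrite ler_wpM2r //.
have -> : expR 3 = expR (3 / k) ^+ n.+2 :> R.
  by rewrite -expRM_natl mulrCA divff ?mulr1 // gt_eqF.
rewrite lerXn2r ?nnegrE ?expR_ge0 ?(ltW rho0) //.
apply: le_trans (expR_ge1Dx _); rewrite le_eqVlt; apply/orP; left; apply/eqP.
by field; rewrite gt_eqF.
Qed.

(** The factor [sqrt (N L)] between the coefficient sum of a homogeneous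
   polynomial of degree [n] and its mean modulus on the torus. *)
Definition sidon : R := Num.sqrt (#|{: midx d n}| * minn #|{: midx d n}| (4 ^ n))%:R.

(** The mean over the torus is taken outside the sum over [j]; pointwise, this
   sum is bounded independently of [d]. *)
Lemma sum_coef_second_deriv_le (x : 'I_d -> C) : (forall i, rnorm (x i) <= 1) ->
  \sum_j \sum_(t : midx d n)
    rnorm (mcoeff (midx_mnm t) (mderiv j (dir_deriv x p))) <=
  sidon * (expR 3 * M * k ^+ 2).
Proof.
move=> x1; pose Q := (n + n).+1.
have [zeta zetaP] := exists_prim_root C (ltn0Sn (n + n)).
have W0 : (0 : R) < (Q ^ #|'I_d|)%:R by rewrite ltr0n expn_gt0.
have hD j : mderiv j (dir_deriv x p) \is ishomog1 n mdeg.
  apply: mderiv_homog; rewrite /dir_deriv; apply: rpred_sum => i _.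
  by apply: rpredZ; apply: mderiv_homog.
rewrite -(ler_pM2l W0) mulr_sumr.
apply: (@le_trans _ _ (\sum_j sidon * \sum_(z : {ffun 'I_d -> 'I_Q})
    rnorm (meval (torus_pt zeta z) (mderiv j (dir_deriv x p))))).
  apply: ler_sum => j _.
  have := sum_coef_le_mean zetaP (@midx_ffun_inj d n) (@midx_ffun_small d n)
    (@midx_collisions d n) (fun t => mcoeff (midx_mnm t) (mderiv j (dir_deriv x p))).
  move/le_trans; apply; rewrite ler_wpM2l ?sqrtr_ge0 //.
  by apply: ler_sum => z _; rewrite (meval_mpol _ (hD j)).
rewrite -mulr_sumr mulrCA ler_wpM2l ?sqrtr_ge0 // exchange_big /=.
apply: (@le_trans _ _ (\sum_(z : {ffun 'I_d -> 'I_Q}) expR 3 * M * k ^+ 2)).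
  apply: ler_sum => z _; have kV0 : 0 < k^-1 by rewrite invr_gt0.
  apply: le_trans (sum_dir_deriv2_le (z := torus_pt zeta z) (x := x) (rho := 1 + k^-1)
    kV0 meval_expanded_le x1 _) _.
    by move=> j; rewrite (rnorm_torus_pt zetaP) ltrDl.
  by rewrite !invrK expr2 mulrA.
by rewrite sumr_const card_ffun !card_ord -[leLHS]mulr_natl.
Qed.

(** The vector [g] norming [y = p(T) h] reduces the claim to
   [grothendieck_functionals]; the constant is [125] times
   [k^2 / (k (k - 1)) <= 2]. *)
Lemma opeval_le (H : hilbert R) (T : 'I_d -> {linear H -> H}) (h : H) :
  (forall j y, rnorm (T j y) <= rnorm y) ->
  (forall i j, T i \o T j = T j \o T i :> (H -> H)) -> rnorm h <= 1 ->
  rnorm (opeval p (fun j => T j) h) <= 250 * expR 3 * sidon * M.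
Proof.
move=> T1 commT h1; set y := opeval _ _ _.
have bound0 : 0 <= 250 * expR 3 * sidon * M.
  have c0 : 0 <= 250 * expR 3 :> R by rewrite mulr_ge0 ?expR_ge0 ?ler0n.
  by rewrite mulr_ge0 // mulr_ge0 ?sqrtr_ge0.
have [->|y0] := eqVneq y 0; first by rewrite rnorm0.
pose F (m : multinom d) := op_monomial T m h.
pose g := (realc (rnorm y))^-1 *: y.
have yn : realc (rnorm y) != 0 by rewrite -rnorm_eq0 rnormC normr_eq0 rnorm_eq0.
have g1 : rnorm g <= 1.
  rewrite -(@ler_pXn2r _ 2) ?nnegrE ?rnorm_ge0 // expr1n -realc_le -inner_sqr.
  rewrite innerZl innerZr -realcV conj_real inner_sqr realcX realcV.
  by rewrite expr2 mulrA mulrACA mulVf // mulr1; apply: lexx.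
have yg : inner H y g = realc (rnorm y).
  rewrite innerZr -realcV conj_real inner_sqr realcX realcV expr2 mulrA.
  by rewrite mulVf // mul1r.
pose c (i : 'I_d) (jt : 'I_d * midx d n) : C :=
  mcoeff (midx_mnm jt.2) (mderiv jt.1 (mderiv i p)).
pose u (jt : 'I_d * midx d n) : H := T jt.1 (F (midx_mnm jt.2)).
have euler : (n.+2 * n.+1)%:R *: y = \sum_i \sum_jt c i jt *: T i (u jt).
  rewrite natrM mulrC -scalerA -[y]/(monomial_sum F p).
  rewrite (monomial_sum_euler_homog F hp) scaler_sumr; apply: eq_bigr => i _.
  rewrite (monomial_sum_euler_homog _ (mderiv_homog i hp)).
  rewrite -(pair_bigA _ (fun j t => c i (j, t) *: T i (u (j, t)))) /=.
  apply: eq_bigr => j _.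
  rewrite /monomial_sum (sum_msupp_midx (mderiv_homog j (mderiv_homog i hp))).
    by apply: eq_bigr => t _; rewrite /u /F /= !op_monomialM.
  by move=> m ->; rewrite scale0r.
have S_le x : (forall i, rnorm (x i) <= 1) ->
    \sum_jt rnorm (\sum_i x i * c i jt) <= sidon * (expR 3 * M * k ^+ 2).
  move=> x1; apply: le_trans (sum_coef_second_deriv_le x1).
  rewrite pair_bigA /= le_eqVlt; apply/orP; left; apply/eqP.
  apply: eq_bigr => -[j t] _ /=; congr rnorm.
  rewrite /dir_deriv (linear_sum (mderiv j)) (raddf_sum (mcoeff _)); apply: eq_bigr => i _ /=.
  by rewrite mderivZ mcoeffZ.
have u1 jt : rnorm (u jt) <= 1.
  apply: le_trans (T1 _ _) _; apply: le_trans h1; exact: op_monomial_le.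
have := grothendieck_functionals S_le u1 T1 g1.
have -> : \sum_i \sum_jt c i jt * inner H (T i (u jt)) g =
    (n.+2 * n.+1)%:R * realc (rnorm y).
  rewrite -yg -innerZl euler inner_suml; apply: eq_bigr => i _.
  by rewrite inner_suml; apply: eq_bigr => jt _; rewrite innerZl.
rewrite -realc_nat -realcM rnormC ger0_norm ?mulr_ge0 ?ler0n ?rnorm_ge0 //.
rewrite natrM -/k => hy.
have n1 : (0 : R) < n.+1%:R by rewrite ltr0n.
have kn : k <= 2 * n.+1%:R by rewrite /k -natrM ler_nat mul2n -addnn ltnS leq_addl.
rewrite -(ler_pM2l (mulr_gt0 k0 n1)); apply: le_trans hy _.
have -> : 125 * (sidon * (expR 3 * M * k ^+ 2)) =
  (k * (125 * expR 3 * sidon * M)) * k by ring.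
have -> : k * n.+1%:R * (250 * expR 3 * sidon * M) =
  (k * (125 * expR 3 * sidon * M)) * (2 * n.+1%:R) by ring.
have c0 : 0 <= 125 * expR 3 :> R by rewrite mulr_ge0 ?expR_ge0 ?ler0n.
apply: ler_wpM2l kn; rewrite mulr_ge0 ?(ltW k0) // mulr_ge0 //.
by rewrite mulr_ge0 ?sqrtr_ge0.
Qed.

End OperatorBound.

(** It suffices that [e >= (4 / 3)^3], which follows from
   [expR (1 / 3) >= 1 + 1 / 3]. *)
Lemma expR1_half_sqr (R : realType) : 4 / 3 <= (expR 1 / 2) ^+ 2 :> R.
Proof.
have e3 : (4 / 3) ^+ 3 <= expR 1 :> R.
  have -> : expR 1 = expR (3^-1) ^+ 3 :> R by rewrite -expRM_natl mulfV.
  have p43 : 0 <= 4 / 3 :> R by lra.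
  rewrite lerXn2r ?nnegrE ?expR_ge0 //.
  by apply: le_trans (expR_ge1Dx _); lra.
have e64 : 64 / 27 <= expR 1 :> R by apply: le_trans e3; lra.
by have := sqr_ge0 (expR 1 - 64 / 27 : R); lra.
Qed.

(** For [d = 2] there are only [n + 1] multi-indices, and both factors under
   the root are at most [n + 1]. For [d >= 3] the factor [4^n] is compensated
   by [N <= 'C(n + 2, 2) (d / 3)^n], because [4 / 3 <= (e / 2)^2]. *)
Lemma sidon_le (R : realType) (d n : nat) : (2 <= d)%N ->
  sidon R d n <= n.+2%:R * (expR 1 / 2) ^+ n * Num.sqrt d%:R ^+ n.
Proof.
case: d => [//|d] d2; have h43 := expR1_half_sqr R.
set e2 : R := expR 1 / 2 in h43 *.
have e0 : 0 <= e2 by rewrite divr_ge0 ?expR_ge0.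
clearbody e2.
have RHS0 : 0 <= n.+2%:R * e2 ^+ n * Num.sqrt d.+1%:R ^+ n.
  by rewrite !mulr_ge0 ?exprn_ge0 ?sqrtr_ge0.
rewrite -[leRHS]ger0_norm // -sqrtr_sqr ler_wsqrtr //.
rewrite !exprMn -!exprM ![(n * 2)%N]mulnC !exprM sqr_sqrtr ?ler0n //.
rewrite card_midx; set N := 'C(d + n, d); set D : R := d.+1%:R.
have D1 : 1 <= D by rewrite ler1n.
have [d1|d3] := leqP d 1.
  have {d2 d1} d1 : d = 1%N by lia.
  have NE : N = n.+1 by rewrite /N d1 bin1 add1n.
  apply: (@le_trans _ _ (n.+2%:R ^+ 2)).
    rewrite -natrX ler_nat (leq_trans (leq_mul (leqnn _) (geq_minl _ _))) //.
    by rewrite NE; lia.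
  have E1 : 1 <= (e2 ^+ 2) ^+ n * D ^+ n.
    by rewrite -exprMn exprn_ege1 // mulr_ege1 //; lra.
  by rewrite -mulrA ler_peMr // exprn_ge0.
have hN : 3 ^+ n * N%:R <= n.+2%:R ^+ 2 * D ^+ n.
  rewrite -!natrX -!natrM ler_nat. apply: leq_trans (@card_midx_pow 2 d n d3) _.
  rewrite leq_mul2r; apply/orP; right.
  by rewrite add2n bin2 /=; lia.
apply: (@le_trans _ _ (N%:R * 4 ^+ n)).
  by rewrite natrM ler_wpM2l // -natrX ler_nat geq_minr.
have -> : 4 ^+ n = 3 ^+ n * (4 / 3) ^+ n :> R by rewrite -exprMn; congr (_ ^+ n); field.
rewrite mulrA [N%:R * _]mulrC.
apply: (@le_trans _ _ (n.+2%:R ^+ 2 * D ^+ n * (e2 ^+ 2) ^+ n)); last by rewrite mulrAC.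
have p43 : 0 <= 4 / 3 :> R by lra.
apply: ler_pM hN _; rewrite ?mulr_ge0 ?exprn_ge0 ?ler0n //.
by rewrite lerXn2r ?nnegrE ?exprn_ge0.
Qed.

(** * The supremum norm and the Agler norm *)

Section Norms.
Variables (R : realType) (d : nat).
Implicit Types p : mpoly d R[i].

Lemma polydiscP (v : 'I_d -> R[i]) : @polydisc R d v <-> forall j, rnorm (v j) < 1.
Proof. by split=> h j; have := h j; rewrite rnorm_lt. Qed.

Lemma supnorm_fin_num p : supnorm p \is a fin_num.
Proof.
rewrite ge0_fin_numE; last first.
  apply: (@le_trans _ _ (rnorm (meval (fun=> 0) p))%:E).
    by rewrite lee_fin rnorm_ge0.
  apply: ereal_sup_ubound; exists (fun=> 0) => //.
  by apply/polydiscP => j; rewrite rnorm0 ltr01.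
apply: (@le_lt_trans _ _ (\sum_(m <- msupp p) rnorm (mcoeff m p))%:E); last first.
  exact: ltry.
apply: ub_ereal_sup => _ [v /polydiscP v1 <-]; rewrite lee_fin.
rewrite -/(rnorm _) mevalE; apply: le_trans (rnorm_sum _ _ _) _.
apply: ler_sum => m _; rewrite rnormM ler_piMr ?rnorm_ge0 //.
elim/big_ind: _ => [|a b ha hb|j _]; first by rewrite rnorm1.
  by rewrite rnormM mulr_ile1 ?rnorm_ge0.
by rewrite rnormX exprn_ile1 ?rnorm_ge0 ?ltW.
Qed.

Lemma rnorm_meval_le_supnorm p (v : 'I_d -> R[i]) :
  (forall j, rnorm (v j) < 1) -> rnorm (meval v p) <= fine (supnorm p).
Proof.
move=> v1; rewrite -lee_fin fineK ?supnorm_fin_num //.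
by apply: ereal_sup_ubound; exists v => //; apply/polydiscP.
Qed.

(** If the supremum is 0, then [p] vanishes on every polydisc by homogeneity,
   in particular at the roots of unity, and Parseval's identity makes all its
   coefficients vanish. *)
Lemma supnorm_gt0 p n : p != 0 -> p \is ishomog1 n mdeg -> 0 < fine (supnorm p).
Proof.
move=> p0 hp; rewrite lt_neqAle; apply/andP; split; last first.
  apply: le_trans (rnorm_ge0 _) (@rnorm_meval_le_supnorm p (fun=> 0) _) => j.
  by rewrite rnorm0 ltr01.
apply: contra p0 => /eqP M0; have [zeta zetaP] := exists_prim_root R[i] (ltn0Sn (n + n)).
have p_torus (z : {ffun 'I_d -> 'I_(n + n).+1}) : rnorm (meval (torus_pt zeta z) p) = 0.
  apply/eqP; rewrite eq_le rnorm_ge0 andbT.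
  have := meval_homog_le hp (ltr0Sn R 1) (@rnorm_meval_le_supnorm p).
  rewrite -M0 mulr0; apply => j.
  by rewrite (rnorm_torus_pt zetaP) ltr1n.
have W0 : (0 : R) < ((n + n).+1 ^ #|'I_d|)%:R by rewrite ltr0n expn_gt0.
have := mpol_parseval zetaP (@midx_ffun_inj d n) (@midx_ffun_small d n)
  (fun t => mcoeff (midx_mnm t) p).
rewrite big1 => [/esym/eqP|z _]; last by rewrite -meval_mpol // p_torus expr0n.
rewrite mulf_eq0 gt_eqF //= psumr_eq0 => [|t _]; last exact: sqr_ge0.
move=> /allP coef0; apply/eqP/mpolyP => m; rewrite mcoeff0.
have [mn|/(dhomog_nemf_coeff hp) //] := eqVneq (mdeg m) n.
have [t <-] := midx_mnm_surj mn.
by have := coef0 t (mem_index_enum t); rewrite sqrf_eq0 rnorm_eq0 => /eqP.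
Qed.

Lemma opnorm_lt1_le (H : hilbert R) (T : {linear H -> H}) x :
  (opnorm T < 1)%E -> rnorm (T x) <= rnorm x.
Proof.
move=> T1; have [->|x0] := eqVneq x 0; first by rewrite linear0.
have xn : 0 < rnorm x by rewrite lt_def rnorm_ge0 rnorm_eq0 x0.
have xc : realc (rnorm x) != 0 by rewrite -rnorm_eq0 rnormC normr_eq0 gt_eqF.
pose u := (realc (rnorm x))^-1 *: x.
have norm_scale a (w : H) : rnorm (a *: w) = rnorm a * rnorm w.
  by apply: (@realcI R); rewrite realcM !rnormE normrZ.
have u1 : rnorm u = 1.
  by rewrite norm_scale rnormV rnormC gtr0_norm // mulVf ?gt_eqF.
have : ((rnorm (T u))%:E <= opnorm T)%E.
  apply: ereal_sup_ubound; exists u => //=.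
  by rewrite -rnormE u1.
move=> /le_lt_trans/(_ T1); rewrite lte_fin linearZ norm_scale rnormV rnormC.
by rewrite gtr0_norm // mulrC ltr_pdivrMr // mul1r => /ltW.
Qed.

Lemma aglernorm_le n p : p \is ishomog1 n.+2 mdeg ->
  (aglernorm p <= (250 * expR 3 * sidon R d n * fine (supnorm p))%:E)%E.
Proof.
move=> hp; apply: ub_ereal_sup => _ [H [T [[T1 commT] ->]]].
apply: ub_ereal_sup => _ [h h1 <-]; rewrite lee_fin -/(rnorm _).
apply: opeval_le => //; first exact: rnorm_meval_le_supnorm.
- by move=> j y; apply: opnorm_lt1_le.
by rewrite rnorm_le.
Qed.

End Norms.

Theorem theorem1p6 (R : realType) :
  exists c : R, forall d k : nat, (2 <= d)%N -> (2 <= k)%N ->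
    (Cconst R k d <=
      (c * k%:R * (expR 1 / 2) ^+ k * (d%:R `^ ((k%:R - 2) / 2)))%:E)%E.
Proof.
exists (250 * expR 3) => d [//|[//|n]] d2 _.
apply: ub_ereal_sup => _ [p [p0 hp] <-].
have M0 := supnorm_gt0 p0 hp.
rewrite -(fineK (supnorm_fin_num p)) inver gt_eqF // lee_pdivrMr //.
apply: le_trans (aglernorm_le hp) _; rewrite -EFinM lee_fin ler_pM2r //.
have E : d%:R `^ ((n.+2%:R - 2) / 2) = Num.sqrt d%:R ^+ n :> R.
  rewrite -powR12_sqrt // -powR_mulrn ?powR_ge0 // -powRrM; congr (_ `^ _).
  by rewrite -[n.+2]addn2 natrD addrK mulrC.
have e1 : 1 <= expR 1 / 2 :> R by have := expR_ge1Dx (1 : R); lra.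
have h : sidon R d n <= n.+2%:R * (expR 1 / 2) ^+ n.+2 * d%:R `^ ((n.+2%:R - 2) / 2).
  apply: le_trans (sidon_le R n d2) _.
  rewrite E ler_wpM2r ?exprn_ge0 ?sqrtr_ge0 // ler_wpM2l // ler_weXn2l //.
  by rewrite -addn2 leq_addr.
have c0 : 0 <= 250 * expR 3 :> R by rewrite mulr_ge0 ?expR_ge0 ?ler0n.
by apply: le_trans (ler_wpM2l c0 h) _; rewrite !mulrA.
Qed.
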